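(* Let $M>0$ and suppose that $g$ is supported on the interval $[-M,M]$. Let $f:\mathbb T\times\mathbb R\times[0,\infty)\to\mathbb R$ be a classical solution of the Kuramoto-Sakaguchi equation with $C^1$ initial datum $f_0$ and $R_0:=R(0)>0$. Suppose $K$ is sufficiently large, depending only on $M$ and $1/R_0$. Then $$\liminf_{t\to\infty}R(t)\ \ge\ R_\infty:=1+\frac MK-\sqrt{\frac{M^2}{K^2}+4\frac MK},$$ and for every $\varepsilon\in(0,1)$, $$\lim_{t\to\infty}\big\|f(\cdot,\cdot,t)\,\mathbf 1_{\mathbb T\setminus L_\infty(t)}\big\|_{L^\infty(\mathbb T\times\mathbb R)}=0,$$ where $L_\infty(t)\subset\mathbb T$ is the time-dependent interval centered at $\phi(t)$ with constant width $$2\arccos\left(\sqrt{1-\left[\frac MK\,\frac{1+R_\infty}{R_\infty^2}+\frac{1-R_\infty}{R_\infty}\right]^2}\right)+\varepsilon .$$ (As $K\to\infty$, $R_\infty$ tends to $1$ and the width of $L_\infty$ can be made arbitrarily small.)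
   Context: $\mathbb T=\mathbb R/2\pi\mathbb Z$. $g\ge0$ is a compactly supported probability density on $\mathbb R$ with $\int_{\mathbb R}\omega g(\omega)\,d\omega=0$, and $K>0$ is the coupling strength. The Kuramoto-Sakaguchi equation for $f=f(\theta,\omega,t)\ge0$ is $$\partial_tf+\partial_\theta(v[f]f)=0,\qquad v[f](\theta,\omega,t)=\omega-K\int_{\mathbb T}\sin(\theta-\theta_* )\rho(\theta_*,t)\,d\theta_*,\qquad \rho(\theta,t)=\int_{\mathbb R}f(\theta,\omega,t)\,d\omega,$$ with initial datum $f(\theta,\omega,0)=f_0(\theta,\omega)\ge0$, $\int_{\mathbb T}f_0(\theta,\omega)\,d\theta=g(\omega)$. The order parameters are defined by $R(t)e^{\mathrm i\phi(t)}=\int_{\mathbb R}\int_{\mathbb T}e^{\mathrm i\theta}f(\theta,\omega,t)\,d\theta\,d\omega$, $R(t)\in[0,1]$; $\phi(t)$ is well defined (mod $2\pi$) when $R(t)>0$. $\mathbf 1_{\mathbb T\setminus L_\infty(t)}$ is the indicator function in the variable $\theta$. *)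

(* Defs.v *)
From HB Require Import structures.
From mathcomp Require Export all_boot all_order all_algebra.
From mathcomp Require Export all_classical all_reals all_analysis.
Export numFieldNormedType.Exports.
Export Order.TTheory GRing.Theory Num.Theory.

#[export] Set Implicit Arguments.
#[export] Unset Strict Implicit.
#[export] Unset Printing Implicit Defensive.

Local Open Scope classical_set_scope.
Local Open Scope ring_scope.

(* A function on T = R/2piZ is represented by a 2pi-periodic function on R,
   and integrals over T are integrals over one period. *)
Definition period {R : realType} : set R := `[- pi, pi].

(* On an open subset D of a finite-dimensional space: the differential exists
   at each point of D and depends continuously on the point. *)
Definition C1_on {R : realType} {V : normedModType R} (D : set V) (h : V -> R) :=
  forall z, D z ->
    differentiable h z /\ forall v, {for z, continuous (fun y => 'D_v h y)}.

Section KuramotoSakaguchi.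
Context {R : realType}.
Implicit Types (M K : R) (g r phi : R -> R).
Implicit Types f : R -> R -> R -> R.

Local Notation leb := (@lebesgue_measure R).

Definition frequency_density g M :=
  [/\ measurable_fun setT g,
      forall w, 0 <= g w,
      (\int[leb]_w (g w)%:E = 1)%E,
      \int[leb]_w (w * g w) = 0
    & closure [set w | g w != 0] `<=` `[- M, M] ].

Definition initial_datum g (f0 : R -> R -> R) :=
  [/\ forall w, periodic (fun x => f0 x w) (pi *+ 2),
      forall x w, 0 <= f0 x w,
      forall w, \int[leb]_(x in period) f0 x w = g w
    & C1_on setT (fun z : R * R => f0 z.1 z.2)].

Definition density f (x t : R) : R := \int[leb]_w f x w t.

Definition velocity K f (x w t : R) : R :=
  w - K * \int[leb]_(y in period) (sin (x - y) * density f y t).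

(* Classical solution of the Cauchy problem: continuous up to t = 0, C^1 and
   solving the equation pointwise for t > 0. Values of f at t < 0 are
   irrelevant. No integrability in w is assumed: it follows, since for fixed w
   the mass over a period is conserved, whence f vanishes where g does. *)
Definition classical_solution K (f0 : R -> R -> R) f :=
  [/\ forall w t : R, 0 <= t -> periodic (fun x => f x w t) (pi *+ 2),
      forall x w t : R, 0 <= t -> 0 <= f x w t,
      forall x w, f x w 0 = f0 x w,
      {within [set z : R * R * R | 0 <= z.2],
        continuous (fun z => f z.1.1 z.1.2 z.2)}
    & C1_on [set z : R * R * R | 0 < z.2] (fun z => f z.1.1 z.1.2 z.2)]
  /\ forall x w t : R, 0 < t ->
       derivable (fun y : R => velocity K f y w t * f y w t) x 1 /\
       derive1 (f x w) t +
         derive1 (fun y : R => velocity K f y w t * f y w t) x = 0.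

(* Real and imaginary parts of r e^(i phi) = \int\int e^(i x) f. When r t = 0
   this puts no constraint on phi t. *)
Definition order_parameters f r phi :=
  forall t : R, 0 <= t ->
    [/\ 0 <= r t <= 1,
        r t * cos (phi t) =
          \int[leb]_w \int[leb]_(x in period) (cos x * f x w t)
      & r t * sin (phi t) =
          \int[leb]_w \int[leb]_(x in period) (sin x * f x w t)].

Definition R_infty M K : R :=
  1 + M / K - Num.sqrt (M ^+ 2 / K ^+ 2 + 4 * (M / K)).

Definition L_infty_width M K (eps : R) : R :=
  let Ri := R_infty M K in
  2 * acos (Num.sqrt
    (1 - (M / K * ((1 + Ri) / Ri ^+ 2) + (1 - Ri) / Ri) ^+ 2)) + eps.

(* The points of R whose class mod 2pi lies in the arc of T with given center
   and width. *)
Definition arc (c width : R) : set R :=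
  [set x | exists k : int, `|x - c - k%:~R * (pi *+ 2)| <= width / 2].

(* The L^infty(T x R) norm (essential supremum). *)
Definition Linfty_norm (h : R -> R -> R) : \bar R :=
  ('N[(leb \x leb)%E]_(+oo)
     [EFin \o ((fun z : R * R => h z.1 z.2) \_ (period `*` setT))])%E.

End KuramotoSakaguchi.

(* Main.v *)
(* Write c, s for the cosine and sine of x - phi, E for the mean against f, and
   S = E[s^2]. Then R' = K R S - E[w s], and R phi' = E[c w] - K R E[s c], so
   that R can decrease only when S = O((M / (K R))^2), and |phi'| is small as
   soon as S or 1 - R is. While S is below a constant of order R^2, an arc
   around phi is a trap for all oscillators, so the mass in it grows, and since
   R is twice this mass minus 1 up to O(S), R loses at most O((M / (K R))^2).
   For S to reach that constant, R must first gain a fixed amount, because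
   S' = O(K S) whereas R' >= K R S / 2. As R <= 1, this happens finitely often:
   eventually S stays small and R bounded below.

   From then on, u = f ((c0 - c)_+)^2 satisfies u_t + v u_x <= - lambda u, so by
   the maximum principle it decays exponentially, and the mass away from phi
   disappears. Hence S >= 1 - R - o(1), which forces R' > 0 as long as
   R < R_infty, because 1 - R_infty exceeds the threshold O((M / (K R))^2). Once
   R is close to R_infty, the bound |E[s c]| <= 1 - R makes the arc L_infty a
   trap, and the same maximum principle gives the uniform decay outside it. *)

(* The obstacle is that R is not monotone: while S is small, the natural frequencies may pull R down
   for an unlimited time. Two other quantities replace it. The smoothed mass near phi ([clustering])
   is nondecreasing while the trap exists, so the loss of R over any time interval is paid by the
   values of S at its two ends. Above the threshold ([thin]), R - (rho / 12) S is nondecreasing,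
   with rho = R_0 / 4 the lower bound maintained for R. An excursion of S up to order rho^2 ([wide])
   thus gains order rho^3 and loses order (M / (K rho))^2; the condition K >= 400 M / rho^3 makes
   the gain win.

   In the decay estimate f alone is no candidate for a maximum principle, since it may grow wherever
   c > 0. The weight removes the inner arc, where mass piles up, and shrinks along trajectories
   faster than f grows.

   The phase is never lifted: c and s are built from the moments E[cos x] and E[sin x],
   differentiable for t > 0. Mass conservation, frequency by frequency, confines f to a compact
   range of w, so every integral lives on a compact rectangle. *)
From mathcomp Require Import ring lra measurable_realfun ess_sup_inf.
Require Import Defs.
Local Open Scope classical_set_scope.
Local Open Scope ring_scope.

(** * Real functions *)

Section RealFunctions.
Context {R : realType}.
Implicit Types (F dF : R -> R) (a b c d k t u : R).

Lemma slope_gt0_near F t d : is_derive t 1 F d -> 0 < d ->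
  exists2 e : R, 0 < e & forall u, `|u - t| < e ->
    (t < u -> F t < F u) /\ (u < t -> F u < F t).
Proof.
move=> Fd d0.
have cF : h^-1 *: (F (h *: 1 + t) - F t) @[h --> 0^'] --> d.
  by have := @ex_derive _ _ _ _ _ _ _ Fd; rewrite /derivable => /cvgP;
     rewrite -(@derive_val _ _ _ _ _ _ _ Fd) /derive; apply.
have /cvgrPdist_lt /(_ _ d0) [e /= e0 he] := cF.
exists e => // u ute.
have key : u != t -> 0 < (u - t)^-1 * (F u - F t).
  move=> uNt; have := he (u - t).
  rewrite /= sub0r normrN subr_eq0 => /(_ ute uNt).
  rewrite /GRing.scale /= mulr1 subrK ltr_norml => /andP[_].
  by rewrite ltrBlDr -ltrBlDl subrr.
split=> h.
  have := key (negbT (gt_eqF h)).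
  by rewrite pmulr_rgt0 ?invr_gt0 ?subr_gt0.
have := key (negbT (lt_eqF h)).
by rewrite nmulr_rgt0 ?invr_lt0 ?subr_lt0.
Qed.

(** A maximum over a space-time cylinder may sit at the final time, where only earlier times are
    available for comparison; what survives is a sign. *)
Lemma derive_ge0_left_max F a t d : a < t -> is_derive t 1 F d ->
  (forall u, a <= u <= t -> F u <= F t) -> 0 <= d.
Proof.
move=> at_ Fd mx; rewrite leNgt; apply/negP => d0.
have Nd : is_derive t 1 (- F) (- d) by apply: is_deriveN.
have [|e e0 he] := slope_gt0_near Nd; first by rewrite oppr_gt0.
pose u := Num.max a (t - e / 2).
have ut : u < t by rewrite /u gt_max at_ /=; lra.
have au : a <= u by rewrite /u le_max lexx.
have tu : t - e / 2 <= u by rewrite /u le_max lexx orbT.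
have [|_ /(_ ut)] := he u; first by rewrite ltr_norml; lra.
rewrite !fctE ltrN2 ltNge => /negP; apply; apply: mx; lra.
Qed.

Lemma is_derive_continuous F t d : is_derive t 1 F d -> {for t, continuous F}.
Proof.
by move=> Fd; apply/differentiable_continuous/derivable1_diffP/ex_derive.
Qed.

Lemma continuous_at_dist F t e : {for t, continuous F} -> 0 < e ->
  exists2 h : R, 0 < h & forall u, `|u - t| < h -> `|F u - F t| < e.
Proof.
move=> /cvgrPdist_lt cF /cF [h /= h0 hh]; exists h => // u.
by rewrite distrC => /hh; rewrite distrC.
Qed.

(** The time is the supremum of the points of [a, b] with F <= k. Continuity is demanded only at
    points after which F exceeds k. Reversed in time, as in [first_above], this suits a bootstrap
    where continuity at a time is known only as long as the bounds hold before it. *)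
Lemma last_below F a b k : a <= b -> F a <= k -> k < F b ->
  (forall t, a <= t <= b -> (forall u, t < u <= b -> k < F u) ->
    {for t, continuous F}) ->
  exists2 u, a <= u < b & F u = k /\ forall t, u < t <= b -> k < F t.
Proof.
move=> ab Fa Fb cF.
pose A := [set t | a <= t <= b /\ F t <= k].
have Aa : A a by split=> //; lra.
have hA : has_sup A by split; [exists a | exists b => x [/andP[]]].
have ub := sup_upper_bound hA; set u := sup A in ub *.
have au : a <= u by apply: ub.
have ub' : u <= b by apply: ge_sup; [exists a | move=> x [/andP[]]].
have after t : u < t <= b -> k < F t.
  move=> /andP[ut tb]; rewrite ltNge; apply/negP => Ft.
  have : t <= u by apply: ub; split => //; lra.
  by rewrite leNgt ut.
have cu : {for u, continuous F} by apply: cF => //; rewrite au.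
have uF : F u <= k.
  rewrite leNgt; apply/negP => Fu.
  have [h h0 hh] := continuous_at_dist cu (ltac:(lra) : 0 < F u - k).
  have [x [xab Fx] xu] := sup_adherent h0 hA.
  have xu' : x <= u by apply: ub.
  have := hh x; rewrite !ltr_norml -/u in xu *; lra.
have ult : u < b.
  by rewrite lt_neqAle ub' andbT; apply/eqP => e; move: uF; rewrite e; lra.
exists u; first by rewrite au.
split=> //; apply/eqP; rewrite eq_le uF /= leNgt; apply/negP => Fu.
have [h h0 hh] := continuous_at_dist cu (ltac:(lra) : 0 < k - F u).
pose t := Num.min b (u + h / 2).
have t1 : u < t by rewrite lt_min ult /=; lra.
have t2 : t <= b by rewrite ge_min lexx.
have t3 : t <= u + h / 2 by rewrite ge_min lexx orbT.
have := after t; rewrite t1 t2 => /(_ isT).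
have := hh t; rewrite !ltr_norml; lra.
Qed.

Lemma first_above F a b k : a <= b -> F a < k -> k <= F b ->
  (forall t, a <= t <= b -> (forall u, a <= u < t -> F u < k) ->
    {for t, continuous F}) ->
  exists2 u, a < u <= b & F u = k /\ forall t, a <= t < u -> F t < k.
Proof.
move=> ab Fa Fb cF.
have [||| u uab [Fu hu]] :=
    @last_below (fun t => - F (a + b - t)) a b (- k) ab.
- by rewrite addrAC subrr add0r lerN2.
- by rewrite addrK ltrN2.
- move=> t tab ht; apply: continuousN.
  apply: (@continuous_comp _ _ _ (fun t => a + b - t) F).
    by apply: continuousB; [exact: cst_continuous | exact: cvg_id].
  apply: cF; first lra.
  move=> u uP; have := ht (a + b - u); rewrite ltrN2 subKr; apply; lra.
exists (a + b - u); first lra.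
split; first by apply: oppr_inj.
move=> t tab; have := hu (a + b - t); rewrite ltrN2 subKr; apply; lra.
Qed.

(** Were F b < k, then F would equal k at the last time it is at least k, and its positive slope
    there would lift it above k just afterwards. *)
Lemma barrier F a b k : a <= b -> continuous F -> k <= F a ->
  (forall t, a <= t <= b -> F t = k -> exists2 d, 0 < d & is_derive t 1 F d) ->
  k <= F b.
Proof.
move=> ab cF Fa dpos; rewrite leNgt; apply/negP => Fb.
have [||| u uab [Fu hu]] := @last_below (fun t => - F t) a b (- k) ab.
- by rewrite lerN2.
- by rewrite ltrN2.
- by move=> t _ _; apply: continuousN; exact: cF.
have {}Fu : F u = k by apply: oppr_inj.
have [|d d0 Fd] := dpos u _ Fu; first lra.
have [e e0 he] := slope_gt0_near Fd d0.
pose t := Num.min b (u + e / 2).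
have t1 : u < t by rewrite lt_min; lra.
have t2 : t <= b by rewrite ge_min lexx.
have t3 : t <= u + e / 2 by rewrite ge_min lexx orbT.
have := hu t; rewrite t1 t2 ltrN2 => /(_ isT).
have [|/(_ t1)] := he t; last by lra.
by rewrite ltr_norml; lra.
Qed.

Lemma growth_ge F dF a b c : a <= b ->
  (forall t, a <= t <= b -> is_derive t 1 F (dF t)) ->
  (forall t, a <= t <= b -> c <= dF t) -> c * (b - a) <= F b - F a.
Proof.
move=> ab Fd dFc.
have [|| t tab ->] := @MVT_segment _ F dF a b ab.
- by move=> x; rewrite in_itv /= => /andP[? ?]; apply: Fd; lra.
- apply: derivable_within_continuous => x; rewrite in_itv /= => xab.
  exact: (@ex_derive _ _ _ _ _ _ _ (Fd _ xab)).
by rewrite ler_wpM2r ?subr_ge0 //; apply: dFc; move: tab; rewrite in_itv.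
Qed.

Lemma reduce_mod_2pi (x : R) : exists k : int,
  - pi <= x - k%:~R * (pi *+ 2) <= pi.
Proof.
have p0 := @pi_gt0 R; have p2 : 0 < pi *+ 2 :> R by rewrite mulrn_wgt0.
exists (Num.floor ((x + pi) / (pi *+ 2))).
have := @Num.Theory.floor_itv R ((x + pi) / (pi *+ 2)).
rewrite intrD ler_pdivlMr // ltr_pdivrMr // mulrDl => /andP[].
by set k := Num.floor _; rewrite mulr2n; lra.
Qed.

Lemma periodic_int (h : R -> R) (T : R) (k : int) (x : R) :
  periodic h T -> h (x - k%:~R * T) = h x.
Proof.
move=> hT; case: k => n.
  by rewrite -{2}(subrK (n%:R * T) x) mulr_natl (periodicn hT).
by rewrite NegzE mulrNz mulNr opprK -[_%:~R]/(n.+1%:R) mulr_natl (periodicn hT).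
Qed.

(** At a maximum of w - eps (t - T0) over one period and [T0, t1], the x-derivative vanishes, and
    with it the transport term, whereas the time derivative of w is at least eps > 0. This
    contradicts the differential inequality. *)
Lemma transport_max_principle (w wx wt v : R -> R -> R) (T0 C : R) :
  (forall t, T0 <= t -> periodic (w^~ t) (pi *+ 2)) ->
  (forall x t : R, T0 <= t -> is_derive x 1 (w^~ t) (wx x t)) ->
  (forall x t : R, T0 <= t -> is_derive t 1 (w x) (wt x t)) ->
  (forall T, {within period `*` `[T0, T], continuous (fun z => w z.1 z.2)}) ->
  (forall x t, T0 <= t -> wt x t + v x t * wx x t <= 0) ->
  (forall x, w x T0 <= C) ->
  forall x t, T0 <= t -> w x t <= C.
Proof.
move=> per dx dt cw tr init x1 t1 t1T; rewrite leNgt; apply/negP => wC.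
have {}t1T : T0 < t1.
  rewrite lt_neqAle t1T andbT; apply/eqP => e.
  by have := init x1; rewrite e leNgt wC.
(* Up to time t1 the penalty consumes half of the excess of w over C, so the maximum of W still
   exceeds C and cannot be attained at time T0. *)
pose eps := (w x1 t1 - C) / (2 * (t1 - T0)).
have eps0 : 0 < eps by apply: divr_gt0; lra.
have epsE : eps * (t1 - T0) = (w x1 t1 - C) / 2 by rewrite /eps; field; lra.
pose W (z : R * R) := w z.1 z.2 - eps * (z.2 - T0).
have cW : {within period `*` `[T0, t1], continuous W}.
  have cV : continuous (fun z : R * R => eps * (z.2 - T0)).
    move=> z; apply: cvgM; first exact: cvg_cst.
    by apply: cvgB; [exact: cvg_snd | exact: cvg_cst].
  by move=> z; apply: cvgB; [exact: cw | exact: (continuous_subspaceT cV)].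
have [k kx] := reduce_mod_2pi x1.
have cA : compact (@period R `*` `[T0, t1]).
  by apply: compact_setX; exact: segment_compact.
have A0 : (@period R `*` `[T0, t1]) !=set0.
  exists (x1 - k%:~R * (pi *+ 2), t1); split; rewrite /period /= in_itv /= //.
  by rewrite ltW //=.
have [[xs ts] /set_mem [/= xsP tsP] mx] := compact_EVT_max A0 cA cW.
move: xsP tsP; rewrite /period /= !in_itv /= => xsP tsP.
(* Periodicity makes the maximum global in x, so that xs counts as interior even if it is an
   endpoint of the period. *)
have {}mx x t : T0 <= t <= t1 -> W (x, t) <= W (xs, ts).
  move=> tP; have [j jx] := reduce_mod_2pi x.
  have <- : W (x - j%:~R * (pi *+ 2), t) = W (x, t).
    rewrite /W /= (@periodic_int (w^~ t)) //; apply: per; lra.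
  by apply: mx; rewrite inE; split; rewrite /period /= in_itv.
have tsT : T0 < ts.
  have Ts : T0 <= ts by lra.
  rewrite lt_neqAle Ts andbT; apply/eqP => e.
  have := mx x1 t1; rewrite lexx (ltW t1T) => /(_ isT).
  by have := init xs; rewrite /W /= -e epsE; lra.
have wx0 : wx xs ts = 0.
  have : is_derive xs 1 (w^~ ts) 0.
    apply: (@derive1_at_max _ (w^~ ts) (xs - 1) (xs + 1)); first lra.
    - by move=> y _; apply: (@ex_derive _ _ _ _ _ _ _ (dx y ts (ltW tsT))).
    - by rewrite in_itv /=; lra.
    - move=> y _; have := mx y ts; rewrite /W /= => /(_ tsP); lra.
  move=> H; have H' := dx xs ts (ltW tsT).
  by rewrite -(@derive_val _ _ _ _ _ _ _ H') (@derive_val _ _ _ _ _ _ _ H).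
have wt0 : 0 <= wt xs ts - eps.
  apply: (@derive_ge0_left_max (fun t => w xs t - eps * (t - T0)) T0 ts) => //.
    have := dt xs ts (ltW tsT) => H.
    by apply: is_derive_eq; rewrite /GRing.scale /=; ring.
  by move=> u uP; apply: (mx xs u); lra.
by have := tr xs ts (ltW tsT); rewrite wx0; lra.
Qed.

(** Handles the kink of [pos_sqr] together with its smooth points: whatever the signs of u and u +
    h, the first-order remainder is at most h^2. *)
Lemma is_derive_quadratic_bound (F : R -> R) (x d C : R) :
  (forall h : R, `|F (h + x) - F x - d * h| <= C * h ^+ 2) -> is_derive x 1 F d.
Proof.
move=> bd.
have cv : h^-1 *: (F (h *: 1 + x) - F x) @[h --> 0^'] --> d.
  apply/cvgrPdist_le => e e0; near=> h.
  have hN : h != 0 by near: h; exact: nbhs_dnbhs_neq.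
  rewrite /GRing.scale /= mulr1.
  have -> : d - h^-1 * (F (h + x) - F x) = - (h^-1 * (F (h + x) - F x - d * h)).
    by field.
  rewrite normrN normrM normfV ler_pdivrMl ?normr_gt0 //.
  apply: le_trans (bd h) _; apply: le_trans (ler_norm _) _.
  rewrite expr2 mulrA normrM mulrC ler_wpM2l // normrM.
  have C1 : 0 < `|C| + 1 by rewrite ltr_wpDl.
  have he : `|h| <= e / (`|C| + 1).
    near: h; apply: dnbhs0_le; exact: divr_gt0.
  apply: (@le_trans _ _ ((`|C| + 1) * `|h|)).
    by rewrite ler_wpM2r // lerDl.
  by rewrite mulrC -ler_pdivlMr.
by apply: DeriveDef; [apply/cvg_ex; exists d | exact: (cvg_lim _ cv)].
Unshelve. all: by end_near. Qed.

Definition pos_sqr (u : R) : R := Num.max 0 u ^+ 2.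

Lemma is_derive_pos_sqr (u : R) : is_derive u 1 pos_sqr (2 * Num.max 0 u).
Proof.
apply: (@is_derive_quadratic_bound _ _ _ 1) => h; rewrite mul1r /pos_sqr.
case: (leP 0 (h + u)) => hu; case: (leP 0 u) => u0.
- by rewrite ger0_norm //; [lra | nra].
- by rewrite ler_norml; apply/andP; split; nra.
- by rewrite ler_norml; apply/andP; split; nra.
- by rewrite ler_norml; apply/andP; split; nra.
Qed.

Lemma continuous_pos_part : continuous (fun u : R => Num.max 0 u).
Proof.
move=> u; exact: (@continuous_max _ _ (cst 0) id u (@cvg_cst _ _ _ _ _) (@cvg_id _ _)).
Qed.

(* A C^1 step increasing from -1 to 1, whose derivative is the tent function
   supported on [-4/5, 4/5]. *)
Definition step (c : R) : R :=
  (25 / 16) * (pos_sqr (c + 4 / 5) - 2 * pos_sqr c + pos_sqr (c - 4 / 5)) - 1.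
Definition dstep (c : R) : R := (25 / 8) *
  (Num.max 0 (c + 4 / 5) - 2 * Num.max 0 c + Num.max 0 (c - 4 / 5)).

Lemma is_derive_step (c : R) : is_derive c 1 step (dstep c).
Proof.
have shift (a : R) : is_derive c 1 (fun c => pos_sqr (c + a)) (2 * Num.max 0 (c + a)).
  have H1 : is_derive c 1 (fun c : R => c + a) 1.
    by apply: is_derive_eq; rewrite addr0.
  have := @is_derive1_comp _ pos_sqr (fun c => c + a) c _ _
    (is_derive_pos_sqr (c + a)) H1.
  by rewrite mulr1.
have H1 := shift (4 / 5); have H2 := shift (- (4 / 5)).
have H3 := is_derive_pos_sqr c.
by rewrite /step; apply: is_derive_eq; rewrite /dstep /GRing.scale /=; field.
Qed.

Lemma continuous_dstep : continuous dstep.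
Proof.
have cm (a : R) : continuous (fun c : R => Num.max 0 (c + a)).
  move=> c; apply: (@continuous_comp _ _ _ (fun c => c + a) (Num.max 0)).
    by apply: cvgD; [exact: cvg_id | exact: cvg_cst].
  exact: continuous_pos_part.
move=> c; apply: cvgM; first exact: cvg_cst.
apply: cvgD; last exact: cm.
apply: cvgB; first exact: cm.
by apply: cvgM; [exact: cvg_cst | exact: continuous_pos_part].
Qed.

Lemma dstep_ge0 c : 0 <= dstep c.
Proof.
rewrite /dstep; case: (leP 0 (c + _)) => h1; case: (leP 0 c) => h2;
  case: (leP 0 (c - _)) => h3; lra.
Qed.

Lemma dstep_eq0 c : 4 / 5 <= `|c| -> dstep c = 0.
Proof.
rewrite ler_normr /dstep => /orP[] hc; case: (leP 0 (c + _)) => h1;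
  case: (leP 0 c) => h2; case: (leP 0 (c - _)) => h3; lra.
Qed.

(** For c a cosine the right-hand side is the squared sine, whose mean is [spread]. For |c| >= 4/5
    [step] equals the sign of c and the error is 1 - |c|; the transition zone is a polynomial
    check. *)
Lemma step_near c : `|c| <= 1 -> `|step c - c| <= 1 - c ^+ 2.
Proof.
rewrite ler_norml /step /pos_sqr => /andP[? ?]; rewrite ler_norml.
case: (leP 0 (c + _)) => h1; case: (leP 0 c) => h2;
  case: (leP 0 (c - _)) => h3; apply/andP; split; nra.
Qed.

End RealFunctions.

(** * Integrals over a rectangle *)

Section RectangleIntegrals.
Context {R : realType}.
Local Notation leb := (@lebesgue_measure R).
Implicit Types H : R * R -> R.

(** The sigma-algebra is the product one; the rational boxes contained in U are countably many and
    cover it. *)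
Lemma open_measurable_prod (U : set (R * R)) :
  open U -> measurable (U : set (measurableTypeR R * measurableTypeR R)).
Proof.
move=> oU.
pose box (q : (rat * rat) * (rat * rat)) : set (R * R) :=
  `]ratr q.1.1, ratr q.1.2[ `*` `]ratr q.2.1, ratr q.2.2[.
have mbox q :
    measurable (box q : set (measurableTypeR R * measurableTypeR R)).
  by apply: measurableX; exact: measurable_itv.
pose F q := if `[< box q `<=` U >] then box q else set0.
have -> : U = \bigcup_q F q.
  apply/seteqP; split=> [[x y] Uxy|z [q _]]; last first.
    by rewrite /F; case: asboolP => // h /h.
  have : nbhs (x, y) U by apply: open_nbhs_nbhs.
  move=> /nbhs_ballP [e /= e0 he].
  have [p1] := rat_in_itvoo (ltac:(lra) : x - e < x).
  have [p2] := rat_in_itvoo (ltac:(lra) : x < x + e).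
  have [q1] := rat_in_itvoo (ltac:(lra) : y - e < y).
  have [q2] := rat_in_itvoo (ltac:(lra) : y < y + e).
  rewrite !in_itv /= => q2P q1P p2P p1P.
  exists ((p1, p2), (q1, q2)) => //; rewrite /F; case: asboolP => [_|].
    by split; rewrite /= in_itv /=; lra.
  case=> -[u v] [/=]; rewrite !in_itv /= => uP vP; apply: he.
  by split; rewrite /ball /= ltr_norml; lra.
apply: countable_bigcupT_measurable => // q.
by rewrite /F; case: asboolP.
Qed.

Lemma continuous_measurable_prod H : continuous H ->
  measurable_fun (setT : set (measurableTypeR R * measurableTypeR R)) H.
Proof.
move=> cH.
apply: (measurability _ (RGenOpens.measurableE R)) => // _ [_ [a [b ->] <-]].
rewrite setTI; apply: open_measurable_prod.
by apply: open_comp => [z _|]; [exact: cH | exact: interval_open].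
Qed.

Local Notation leb2 := (leb \x leb)%E.

Lemma bounded_on_compact {T : topologicalType} (A : set T) (h : T -> R) :
  compact A -> {within A, continuous h} ->
  exists2 C, 0 <= C & forall z, A z -> `|h z| <= C.
Proof.
move=> cA ch.
have /compact_bounded [C [_ hC]] := continuous_compact ch cA.
exists (`|C| + 1) => [|z Az]; first by rewrite addr_ge0.
by apply: hC; [rewrite ltr_pwDr // ler_norm | exists z].
Qed.

Variables a b c d : R.
Let A : set R := `[a, b].
Let B : set R := `[c, d].

Lemma compact_rectangle : compact (A `*` B).
Proof. by apply: compact_setX; exact: segment_compact. Qed.

Lemma measurable_rectangle :
  measurable (A `*` B : set (measurableTypeR R * measurableTypeR R)).
Proof. by apply: measurableX; exact: measurable_itv. Qed.

Lemma rectangle_measure_fin : (leb2 (A `*` B) < +oo)%E.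
Proof.
have fin x y : exists u : R, leb `[x, y] = u%:E.
  rewrite lebesgue_measure_itv /=; case: ifPn => _; last by exists 0.
  by exists (y - x); rewrite EFinB.
have [u hu] := fin a b; have [v hv] := fin c d.
rewrite product_measure1E; try exact: measurable_itv.
by rewrite [X in (X * _)%E]hu [X in (_ * X)%E]hv -EFinM ltry.
Qed.

Lemma integrable_rectangle H : continuous H ->
  leb2.-integrable (A `*` B) (EFin \o H).
Proof.
move=> cH; apply: measurable_bounded_integrable.
- exact: measurable_rectangle.
- exact: rectangle_measure_fin.
- exact: (measurable_funS _ _ (continuous_measurable_prod cH)).
- have [C C0 hC] := bounded_on_compact compact_rectangle
    (continuous_subspaceT cH).
  exists C; split; first exact: num_real.
  by move=> x Cx z Az; exact: le_trans (hC z Az) (ltW Cx).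
Qed.

Lemma integrable_segment (h : R -> R) (x y : R) : continuous h ->
  leb.-integrable `[x, y] (EFin \o h).
Proof.
move=> ch; apply: continuous_compact_integrable; first exact: segment_compact.
exact: continuous_subspaceT.
Qed.

Lemma continuous_pair {S T U : topologicalType} (f : S -> T) (g : S -> U) :
  continuous f -> continuous g -> continuous (fun s => (f s, g s)).
Proof. by move=> cf cg s; exact: (cvg_pair (cf s) (cg s)). Qed.

Lemma continuous_slice1 H y : continuous H -> continuous (fun x => H (x, y)).
Proof.
move=> cH x; apply: (@continuous_comp _ _ _ (pair^~ y) H); last exact: cH.
by apply: (@continuous_pair _ _ _ id (cst y)) => z; [exact: cvg_id|exact: cvg_cst].
Qed.

Lemma continuous_slice2 H x : continuous H -> continuous (fun y => H (x, y)).
Proof.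
move=> cH y; apply: (@continuous_comp _ _ _ (pair x) H); last exact: cH.
by apply: (@continuous_pair _ _ _ (cst x) id) => z; [exact: cvg_cst|exact: cvg_id].
Qed.

(** Both orders of integration occur: frequency outside for the order parameters and for integration
    by parts in the angle, angle outside for the velocity, which integrates the density. *)
Lemma Rintegral_rectangle21 H : continuous H ->
  \int[leb2]_(z in A `*` B) H z =
  \int[leb]_(y in B) \int[leb]_(x in A) H (x, y).
Proof.
move=> cH; rewrite /Rintegral; congr fine.
rewrite [LHS]integral_mkcond [RHS]integral_mkcond.
rewrite -(@integral21_prod_meas1 _ _ _ _ _ leb leb); last first.
  apply/integrable_restrict => //; first exact: measurable_rectangle.
  by rewrite setTI; exact: integrable_rectangle.
apply: eq_integral => y _; rewrite /fubini_G patchE.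
case: ifPn => yB.
  rewrite fineK; last first.
    apply: integrable_fin_num; first exact: measurable_itv.
    exact/integrable_segment/continuous_slice1.
  rewrite [RHS]integral_mkcond; apply: eq_integral => x _.
  by rewrite !patchE in_setX yB andbT.
by apply: integral0_eq => x _; rewrite patchE in_setX (negbTE yB) andbF.
Qed.

Lemma Rintegral_rectangle12 H : continuous H ->
  \int[leb2]_(z in A `*` B) H z =
  \int[leb]_(x in A) \int[leb]_(y in B) H (x, y).
Proof.
move=> cH; rewrite /Rintegral; congr fine.
rewrite [LHS]integral_mkcond [RHS]integral_mkcond.
rewrite -(@integral12_prod_meas1 _ _ _ _ _ leb leb); last first.
  apply/integrable_restrict => //; first exact: measurable_rectangle.
  by rewrite setTI; exact: integrable_rectangle.
apply: eq_integral => x _; rewrite /fubini_F patchE.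
case: ifPn => xA.
  rewrite fineK; last first.
    apply: integrable_fin_num; first exact: measurable_itv.
    exact/integrable_segment/continuous_slice2.
  rewrite [RHS]integral_mkcond; apply: eq_integral => y _.
  by rewrite !patchE in_setX xA.
by apply: integral0_eq => y _; rewrite patchE in_setX (negbTE xA).
Qed.

Lemma le_Rintegral_rectangle H1 H2 : continuous H1 -> continuous H2 ->
  (forall z, (A `*` B) z -> H1 z <= H2 z) ->
  \int[leb2]_(z in A `*` B) H1 z <= \int[leb2]_(z in A `*` B) H2 z.
Proof.
move=> c1 c2 h12; apply: le_Rintegral => //; try exact: integrable_rectangle.
exact: measurable_rectangle.
Qed.

Lemma continuous_Rintegral_rectangle (h : R -> R * R -> R) :
  continuous (fun p : (R * R) * R => h p.2 p.1) ->
  continuous (fun t => \int[leb2]_(z in A `*` B) h t z).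
Proof.
move=> ch t0.
have ct t : continuous (h t).
  move=> z; apply: (@continuous_comp _ _ _ (pair^~ t) (fun p => h p.2 p.1)).
    by apply: (@continuous_pair _ _ _ id (cst t)) => y;
      [exact: cvg_id|exact: cvg_cst].
  exact: ch.
have cz z : continuous (h^~ z).
  move=> t; apply: (@continuous_comp _ _ _ (pair z) (fun p => h p.2 p.1)).
    by apply: (@continuous_pair _ _ _ (cst z) id) => y;
      [exact: cvg_cst|exact: cvg_id].
  exact: ch.
have cK : compact ((A `*` B) `*` `[t0 - 1, t0 + 1]).
  by apply: compact_setX; [exact: compact_rectangle | exact: segment_compact].
have [C C0 hC] := bounded_on_compact cK (continuous_subspaceT ch).
have := @continuity_under_integral _ _ _ leb2 h (A `*` B) measurable_rectangle
  (t0 - 1) (t0 + 1) _ _ (cst C) _ _ t0; apply.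
- by move=> t _; exact: integrable_rectangle.
- by apply: aeW => z _ t _; exact: cz.
- by apply: integrable_rectangle => z; exact: cvg_cst.
- move=> t tI; apply: aeW => z Az; apply: (hC (z, t)); split => //=.
  by move: tI; rewrite /= !in_itv /=; lra.
- by rewrite inE /= in_itv /=; lra.
Qed.

Lemma is_derive_Rintegral_rectangle (h dh : R -> R * R -> R) (t0 e C : R) :
  0 < e ->
  (forall t, `|t - t0| < e -> continuous (h t)) ->
  (forall (t : R) z, `|t - t0| < e -> (A `*` B) z ->
    is_derive t 1 (h^~ z) (dh t z)) ->
  (forall t z, `|t - t0| < e -> (A `*` B) z -> `|dh t z| <= C) ->
  is_derive t0 1 (fun t => \int[leb2]_(z in A `*` B) h t z)
    (\int[leb2]_(z in A `*` B) dh t0 z).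
Proof.
move=> e0 ch dP bd.
have inI t : t \in `]t0 - e, t0 + e[ -> `|t - t0| < e.
  by rewrite in_itv /= ltr_norml; lra.
have t0I : `]t0 - e, t0 + e[%classic t0 by rewrite /= in_itv /=; lra.
have dE t z : `]t0 - e, t0 + e[%classic t -> (A `*` B) z ->
    partial1of2 h t z = dh t z.
  move=> tI Dz; rewrite partial1of2E.
  exact: (@derive_val _ _ _ _ _ _ _ (dP t z (inI t tI) Dz)).
have int t : `]t0 - e, t0 + e[%classic t ->
    leb2.-integrable (A `*` B) (EFin \o h t).
  by move=> tI; apply: integrable_rectangle; exact/ch/inI.
have der t z : `]t0 - e, t0 + e[%classic t -> (A `*` B) z ->
    derivable (h^~ z) t 1.
  by move=> tI Dz; exact: (@ex_derive _ _ _ _ _ _ _ (dP t z (inI t tI) Dz)).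
have C0 z : 0 <= (cst `|C| : R * R -> R) z by [].
have intC : leb2.-integrable (A `*` B) (EFin \o (cst `|C| : R * R -> R)).
  by apply: integrable_rectangle => z; exact: cvg_cst.
have ub t z : `]t0 - e, t0 + e[%classic t -> (A `*` B) z ->
    `|partial1of2 h t z| <= (cst `|C| : R * R -> R) z.
  by move=> tI Dz; rewrite dE //; apply: le_trans (bd _ _ (inI t tI) Dz) (ler_norm _).
have dv := @derivable_under_integral _ _ _ leb2 h (A `*` B)
  measurable_rectangle t0 (t0 - e) (t0 + e) t0I int der _ C0 intC ub.
have := @differentiation_under_integral _ _ _ leb2 h (A `*` B)
  measurable_rectangle t0 (t0 - e) (t0 + e) t0I int der _ C0 intC ub.
rewrite derive1E => E; apply: DeriveDef => //; rewrite E.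
by apply: eq_Rintegral => z /set_mem Dz; exact: dE.
Qed.

End RectangleIntegrals.

Lemma Rintegral_period_derive {R : realType} (F dF : R -> R) :
  periodic F (pi *+ 2) -> (forall x : R, is_derive x 1 F (dF x)) ->
  continuous dF -> \int[@lebesgue_measure R]_(x in period) dF x = 0.
Proof.
move=> pF FdF cdF.
have cF x : {for x, continuous F} := is_derive_continuous (FdF x).
have pp : - pi < pi :> R by have := @pi_gt0 R; lra.
rewrite /Rintegral (@continuous_FTC2 _ dF F) //.
- have -> : F pi = F (- pi) by rewrite -(pF (- pi)) mulr2n addKr.
  by rewrite -EFinB subrr.
- exact: continuous_subspaceT.
- split=> [x _||]; first exact: (@ex_derive _ _ _ _ _ _ _ (FdF x)).
  + exact: cvg_at_right_filter (cF _).
  + exact: cvg_at_left_filter (cF _).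
- by move=> x _; rewrite derive1E; exact: (@derive_val _ _ _ _ _ _ _ (FdF x)).
Qed.

Lemma continuous_add {T : topologicalType} {R : realType} (h k : T -> R) :
  continuous h -> continuous k -> continuous (fun z => h z + k z).
Proof. by move=> ch ck z; apply: cvgD; [exact: ch | exact: ck]. Qed.

Lemma continuous_opp {T : topologicalType} {R : realType} (h : T -> R) :
  continuous h -> continuous (fun z => - h z).
Proof. by move=> ch z; apply: cvgN; exact: ch. Qed.

Lemma continuous_mul {T : topologicalType} {R : realType} (h k : T -> R) :
  continuous h -> continuous k -> continuous (fun z => h z * k z).
Proof. by move=> ch ck z; apply: cvgM; [exact: ch | exact: ck]. Qed.

Lemma continuous_comp_real {T : topologicalType} {R : realType} (h : R -> R)
    (k : T -> R) : continuous h -> continuous k -> continuous (fun z => h (k z)).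
Proof.
by move=> ch ck z; apply: (@continuous_comp _ _ _ k h); [exact: ck | exact: ch].
Qed.

Lemma continuous_sqr {T : topologicalType} {R : realType} (h : T -> R) :
  continuous h -> continuous (fun z => h z ^+ 2).
Proof.
move=> ch; rewrite (_ : (fun z => _) = (fun z => h z * h z)).
  exact: continuous_mul.
by apply/funext => z; rewrite expr2.
Qed.

Ltac solve_continuous :=
  cbv beta;
  lazymatch goal with
  | |- continuous (fun _ => ?c) => by move=> ?; exact: cvg_cst
  | |- continuous (fun z => (@?h z + @?k z)%R) =>
      apply: (@continuous_add _ _ h k); solve_continuous
  | |- continuous (fun z => (@?h z * @?k z)%R) =>
      apply: (@continuous_mul _ _ h k); solve_continuous
  | |- continuous (fun z => (@?h z ^+ 2)%R) =>
      apply: (@continuous_sqr _ _ h); solve_continuous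
  | |- continuous (fun z => (- @?h z)%R) =>
      apply: (@continuous_opp _ _ h); solve_continuous
  | |- continuous (fun z => cos (@?k z)) =>
      apply: (@continuous_comp_real _ _ cos k);
      [exact: continuous_cos | solve_continuous]
  | |- continuous (fun z => sin (@?k z)) =>
      apply: (@continuous_comp_real _ _ sin k);
      [exact: continuous_sin | solve_continuous]
  | |- _ => first [ assumption
                  | by move=> ?; exact: cvg_fst
                  | by move=> ?; exact: cvg_snd
                  | by move=> ?; exact: cvg_id
                  | by move=> ?; exact: cvg_cst
                  | exact: continuous_cos
                  | exact: continuous_sin
                  | idtac ]
  end.

(** A positive value of h would keep h above half of it on an interval of positive length inside
    [a, b]. *)
Lemma Rintegral_continuous_eq0 {R : realType} (h : R -> R) (a b : R) :
  a < b -> continuous h -> (forall x, 0 <= h x) ->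
  \int[@lebesgue_measure R]_(x in `[a, b]) h x = 0 ->
  forall x, a <= x <= b -> h x = 0.
Proof.
move=> ab ch h0 ih x xab; apply/eqP; rewrite eq_le h0 andbT leNgt; apply/negP.
move=> hx; pose e := h x / 2.
have e0 : 0 < e by rewrite divr_gt0.
have [d d0 hd] := continuous_at_dist (ch x) e0.
pose u := Num.max a (x - d / 2); pose v := Num.min b (x + d / 2).
have au : a <= u by rewrite /u le_max lexx.
have xdu : x - d / 2 <= u by rewrite /u le_max lexx orbT.
have vb : v <= b by rewrite /v ge_min lexx.
have vxd : v <= x + d / 2 by rewrite /v ge_min lexx orbT.
have uv : u < v by rewrite /u /v gt_max !lt_min; lra.
have sub : `[u, v] `<=` `[a, b] by apply: subset_itv; rewrite bnd_simp.
have low : e * (v - u) <= \int[@lebesgue_measure R]_(y in `[u, v]) h y.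
  have -> : e * (v - u) = \int[@lebesgue_measure R]_(y in `[u, v]) (cst e y).
    rewrite Rintegral_cst /=; last exact: measurable_itv.
    by rewrite lebesgue_measure_itv /= lte_fin uv.
  apply: le_Rintegral; first exact: measurable_itv.
  - by apply: integrable_segment => z; exact: cvg_cst.
  - exact: integrable_segment.
  move=> y; rewrite /= in_itv /= => yuv.
  by have := hd y; rewrite !ltr_norml /e; lra.
have up : \int[@lebesgue_measure R]_(y in `[u, v]) h y <=
          \int[@lebesgue_measure R]_(y in `[a, b]) h y.
  apply: fine_le.
  - by apply: integrable_fin_num; [exact: measurable_itv | exact: integrable_segment].
  - by apply: integrable_fin_num; [exact: measurable_itv | exact: integrable_segment].
  apply: ge0_subset_integral => //; try exact: measurable_itv.
  - apply/measurable_EFinP; apply: measurable_funTS.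
    exact: continuous_measurable_fun.
  - by move=> y _; rewrite lee_fin.
have evu : 0 < e * (v - u) by apply: mulr_gt0; rewrite ?subr_gt0.
by move: (lt_le_trans evu (le_trans low up)); rewrite ih ltxx.
Qed.

(** * Moments of a classical solution *)

Section Solution.
Context {R : realType}.
Local Notation leb := (@lebesgue_measure R).
Local Notation leb2 := (leb \x leb)%E.
Variables (M K : R) (g : R -> R) (f0 : R -> R -> R) (f : R -> R -> R -> R).
Hypotheses (M0 : 0 < M) (gP : frequency_density g M)
  (f0P : initial_datum g f0) (fP : classical_solution K f0 f).

(* [f] frozen at its initial value for [t < 0], which makes it continuous on
   the whole space. *)
Let fe (x w t : R) := f x w (Num.max t 0).

Local Lemma feE x w (t : R) : 0 <= t -> fe x w t = f x w t.
Proof. by move=> t0; rewrite /fe; case: (ltP t 0) => //; lra. Qed.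

Local Lemma fe_ge0 x w t : 0 <= fe x w t.
Proof. by have [[_ H _ _ _] _] := fP; apply: H; rewrite le_max lexx orbT. Qed.

Local Lemma fe_periodic w t : periodic (fun x => fe x w t) (pi *+ 2).
Proof. by have [[H _ _ _ _] _] := fP; apply: H; rewrite le_max lexx orbT. Qed.

(** The map [rho] retracts space-time onto t >= 0, and continuity relative to that closed set pulls
    back along it. *)
Lemma continuous_fe : continuous (fun p : R * R * R => fe p.1.1 p.1.2 p.2).
Proof.
have [[_ _ _ cw _] _] := fP.
pose S := [set z : R * R * R | 0 <= z.2].
pose rho (p : R * R * R) : R * R * R := (p.1, Num.max p.2 0).
have crho : continuous rho.
  apply: continuous_pair; first by move=> p; exact: cvg_fst.
  apply: (@continuous_comp_real _ _ (Num.max^~ 0)) => t; last exact: cvg_snd.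
  exact: (@continuous_max _ _ id (cst 0) t (@cvg_id _ _) (@cvg_cst _ _ _ _ _)).
have Srho p : S (rho p) by rewrite /S /rho /= le_max lexx orbT.
move=> p; have := cw (rho p).
move=> H U HU; have /= := H U HU.
rewrite /from_subspace /nbhs /= -(nbhs_subspace_in (Srho p)) => hV.
have := crho p _ hV; rewrite /nbhs /=.
by apply: filterS => q /= /(_ (Srho q)).
Qed.

Let F3 (p : R * R * R) : R := f p.1.1 p.1.2 p.2.

Definition dtime (x w t : R) : R := derive1 (f x w) t.
Definition dangle (x w t : R) : R := derive1 (fun y => f y w t) x.

Local Lemma quotient_time x w t :
  (fun h : R => h^-1 *: (F3 (h *: (0, 0, 1) + (x, w, t)) - F3 (x, w, t))) =
  (fun h : R => h^-1 *: (f x w (h *: 1 + t) - f x w t)).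
Proof.
by apply/funext => h; rewrite /F3 /= /GRing.scale /= !mulr0 !add0r mulr1.
Qed.

Local Lemma quotient_angle x w t :
  (fun h : R => h^-1 *: (F3 (h *: (1, 0, 0) + (x, w, t)) - F3 (x, w, t))) =
  (fun h : R => h^-1 *: (f (h *: 1 + x) w t - f x w t)).
Proof.
by apply/funext => h; rewrite /F3 /= /GRing.scale /= !mulr0 !add0r mulr1.
Qed.

Local Lemma C1 (p : R * R * R) : 0 < p.2 ->
  differentiable F3 p /\ forall v, {for p, continuous (fun y => 'D_v F3 y)}.
Proof. by have [[_ _ _ _ H] _] := fP => p0; apply: H. Qed.

Local Lemma dtimeE :
  'D_(0, 0, 1) F3 = (fun p : R * R * R => dtime p.1.1 p.1.2 p.2).
Proof.
apply/funext => -[[x w] t].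
by rewrite /dtime derive1E /derive /= quotient_time.
Qed.

Lemma is_derive_time (x w t : R) : 0 < t ->
  is_derive t 1 (f x w) (dtime x w t).
Proof.
move=> t0; have [/diff_derivable d _] := @C1 (x, w, t) t0.
apply: DeriveDef; last by rewrite /dtime derive1E.
by have := d (0, 0, 1); rewrite /derivable /= quotient_time.
Qed.

Lemma is_derive_angle (x w t : R) : 0 < t ->
  is_derive x 1 (fun y => f y w t) (dangle x w t).
Proof.
move=> t0; have [/diff_derivable d _] := @C1 (x, w, t) t0.
apply: DeriveDef; last by rewrite /dangle derive1E.
by have := d (1, 0, 0); rewrite /derivable /= quotient_angle.
Qed.

Lemma continuous_dtime (p : R * R * R) : 0 < p.2 ->
  {for p, continuous (fun p : R * R * R => dtime p.1.1 p.1.2 p.2)}.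
Proof. by move=> p0; rewrite -dtimeE; have [_] := C1 p0; apply. Qed.

Local Lemma is_derive_fe (x w t : R) : 0 < t ->
  is_derive t 1 (fe x w) (dtime x w t).
Proof.
move=> t0; have Hd := is_derive_time x w t0.
apply: near_eq_is_derive Hd; rewrite ?oner_neq0 //.
by near=> u; rewrite feE //; apply/ltW; near: u; exact: lt_nbhsr.
Unshelve. all: by end_near. Qed.

Lemma continuous_fe_slice t : continuous (fun z : R * R => fe z.1 z.2 t).
Proof.
move=> z; apply: (@continuous_comp _ _ _ (pair^~ t)
  (fun p : R * R * R => fe p.1.1 p.1.2 p.2)); last exact: continuous_fe.
by apply: (@continuous_pair _ _ _ id (cst t)) => y;
  [exact: cvg_id | exact: cvg_cst].
Qed.

Lemma continuous_dtime_slice t : 0 < t ->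
  continuous (fun z : R * R => dtime z.1 z.2 t).
Proof.
move=> t0 z; apply: (@continuous_comp _ _ _ (pair^~ t)
  (fun p : R * R * R => dtime p.1.1 p.1.2 p.2)); last exact: continuous_dtime.
by apply: (@continuous_pair _ _ _ id (cst t)) => y;
  [exact: cvg_id | exact: cvg_cst].
Qed.

Lemma velocity_periodic w t : periodic (fun x => velocity K f x w t) (pi *+ 2).
Proof.
move=> x; rewrite /velocity; congr (_ - _ * _).
by apply: eq_Rintegral => y _; rewrite addrAC sinD2pi.
Qed.

(** The equation speaks of the derivative of the product v f. At this stage the velocity is an
    integral over all frequencies of unknown regularity, so the first integrations by parts act on
    the whole flux. *)
Lemma is_derive_flux (x w t : R) : 0 < t ->
  is_derive x 1 (fun y => velocity K f y w t * f y w t) (- dtime x w t).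
Proof.
move=> t0; have [_ H] := fP; have [dv /eqP] := H x w t t0.
rewrite addrC addr_eq0 => /eqP E.
by apply: DeriveDef => //; rewrite -derive1E E.
Qed.

Local Lemma cont_fe_comp {T : topologicalType} (u v w : T -> R) : continuous u ->
  continuous v -> continuous w -> continuous (fun z => fe (u z) (v z) (w z)).
Proof.
move=> cu cv cw z; apply: (@continuous_comp _ _ _
  (fun z => (u z, v z, w z)) (fun p : R * R * R => fe p.1.1 p.1.2 p.2)).
  by apply: continuous_pair => //; exact: continuous_pair.
exact: continuous_fe.
Qed.

Local Lemma cont_dtime_comp {T : topologicalType} (u v : T -> R) (t : R) : 0 < t ->
  continuous u -> continuous v -> continuous (fun z => dtime (u z) (v z) t).
Proof.
move=> t0 cu cv z; apply: (@continuous_comp _ _ _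
  (fun z => (u z, v z)) (fun p : R * R => dtime p.1 p.2 t)).
  exact: continuous_pair.
exact: continuous_dtime_slice.
Qed.

Local Lemma dtime_bounded (A : set (R * R)) (t0 : R) : compact A -> 0 < t0 ->
  exists C : R,
  forall z t, A z -> `|t - t0| <= t0 / 2 -> `|dtime z.1 z.2 t| <= C.
Proof.
move=> cA t00.
have cK : compact (A `*` `[t0 / 2, t0 + t0 / 2]).
  by apply: compact_setX => //; exact: segment_compact.
have [|C _ hC] := @bounded_on_compact _ _ _
    (fun p : R * R * R => dtime p.1.1 p.1.2 p.2) cK.
  apply: continuous_in_subspaceT => p; rewrite inE => -[_ /=].
  by rewrite in_itv /= => pt; apply: continuous_dtime; lra.
exists C => z t Az tt0; apply: (hC (z, t)); split => //=.
by rewrite in_itv /=; move: tt0; rewrite ler_norml; lra.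
Qed.

Local Lemma Rintegral_unit (r : R) : \int[leb]_(y in `[0, 1]) r = r.
Proof.
rewrite -[LHS]/(\int[leb]_(y in `[0, 1]) (cst r y)) Rintegral_cst /=.
  by rewrite lebesgue_measure_itv /= lte_fin ltr01 oppr0 adde0 mulr1.
exact: measurable_itv.
Qed.

(** For each w separately the equation is a conservation law on the circle, and the periodic flux
    has an x-derivative of integral zero. The mass is differentiable for t > 0; its continuity at 0
    lets the mean value theorem reach the initial datum. *)
Lemma mass_conserved w (t : R) : 0 <= t -> \int[leb]_(x in period) f x w t = g w.
Proof.
move=> t0; have [_ _ mass0 _] := f0P; have [[_ _ init _ _] _] := fP.
(* A dummy variable in [0, 1] turns the mass over a period into an integral over a rectangle, where
   continuity and differentiation in t are available. *)
pose D : set (R * R) := (period `*` `[0, 1]).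
pose m (u : R) := \int[leb2]_(z in D) fe z.1 w u.
have mE (u : R) : 0 <= u -> m u = \int[leb]_(x in period) f x w u.
  move=> u0; rewrite /m /D Rintegral_rectangle21; last first.
    by apply: cont_fe_comp; solve_continuous.
  rewrite /= Rintegral_unit.
  by apply: eq_Rintegral => x _; rewrite feE.
have cm : continuous m.
  apply: (@continuous_Rintegral_rectangle _ _ _ _ _
    (fun u (z : R * R) => fe z.1 w u)).
  apply: (@cont_fe_comp _ (fun p : R * R * R => p.1.1) _ snd).
  - by move=> p; apply: (@continuous_comp _ _ _ fst fst);
      [exact: cvg_fst | exact: cvg_fst].
  - by move=> p; exact: cvg_cst.
  - by move=> p; exact: cvg_snd.
have dm (u : R) : 0 < u -> is_derive u 1 m 0.
  move=> u0.
  have cD := @compact_rectangle R (- pi) pi 0 1.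
  have cW : compact (period `*` [set w] : set (R * R)).
    by apply: compact_setX; [exact: segment_compact | exact: compact_set1].
  have [C hC] := dtime_bounded cW u0.
  have -> : 0 = \int[leb2]_(z in D) dtime z.1 w u.
    rewrite /D Rintegral_rectangle21; last first.
      by apply: cont_dtime_comp => //; solve_continuous.
    rewrite /= Rintegral_unit.
    under eq_Rintegral do rewrite -[dtime _ _ _]opprK -mulN1r.
    rewrite RintegralZl; last 2 first.
    - exact: measurable_itv.
    - apply: integrable_segment; apply: continuous_opp.
      by apply: cont_dtime_comp => //; solve_continuous.
    suff -> : \int[leb]_(x in period) - dtime x w u = 0 by rewrite mulr0.
    apply: (@Rintegral_period_derive _ (fun y => velocity K f y w u * f y w u)
      (fun y => - dtime y w u)).
    - move=> x; rewrite [velocity _ _ _ _ _]velocity_periodic; congr (_ * _).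
      by have [[H _ _ _ _] _] := fP; apply: H; rewrite ltW.
    - by move=> x; exact: is_derive_flux.
    - apply: continuous_opp; apply: cont_dtime_comp => //; solve_continuous.
  apply: (@is_derive_Rintegral_rectangle _ _ _ _ _
    (fun u (z : R * R) => fe z.1 w u) (fun u z => dtime z.1 w u) u (u / 2) C).
  - by rewrite divr_gt0.
  - by move=> s _; apply: cont_fe_comp; solve_continuous.
  - move=> s z; rewrite ltr_norml => su _; apply: is_derive_fe; lra.
  - by move=> s z su [Dz _]; apply: (hC (z.1, w) s) => //; exact: ltW.
have := @MVT_segment _ m (cst 0) 0 t t0; case.
- by move=> x; rewrite in_itv /= => /andP[x0 _]; exact: dm.
- exact: continuous_subspaceT.
move=> c _; rewrite mul0r mE // mE // => /eqP; rewrite subr_eq0 => /eqP ->.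
by rewrite -mass0; apply: eq_Rintegral => x _; rewrite init.
Qed.

(** At such w the conserved mass g w is zero, and a nonnegative continuous function of mass zero
    vanishes. This restricts all integrals in w to [-M, M] and so provides integrability. *)
Lemma support_bounded x w (t : R) : 0 <= t -> M < `|w| -> f x w t = 0.
Proof.
move=> t0 Mw; have [_ g0 _ _ supp] := gP.
have gw : g w = 0.
  apply/eqP/negPn/negP => gw.
  have := supp w (@subset_closure _ [set w | g w != 0] w gw).
  by rewrite /= in_itv /= -ler_norml leNgt Mw.
have [k kx] := reduce_mod_2pi x.
rewrite -(feE _ _ t0) -(@periodic_int _ (fun x => fe x w t) _ k x (fe_periodic w t)).
apply: (@Rintegral_continuous_eq0 _ (fun x => fe x w t) (- pi) pi) => //.
- by have := @pi_gt0 R; lra.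
- by apply: cont_fe_comp; solve_continuous.
- by move=> y; exact: fe_ge0.
- by rewrite -gw -(mass_conserved w t0); apply: eq_Rintegral => y _; rewrite feE.
Qed.

(** * Means against the solution and the weak form of the equation *)

Definition band : set (R * R) := (period `*` `[- M, M]).

(** Integrating over the compact [band] loses nothing for t >= 0, by [support_bounded]; freezing f
    at negative times makes the mean continuous in t on the whole line. *)
Definition mean (t : R) (H : R * R -> R) : R :=
  \int[leb2]_(z in band) (H z * f z.1 z.2 (Num.max t 0)).

Local Lemma cont_mul_fe (H : R * R -> R) t : continuous H ->
  continuous (fun z : R * R => H z * fe z.1 z.2 t).
Proof. by move=> cH; apply: continuous_mul => //; exact: continuous_fe_slice. Qed.

Lemma le_mean (t : R) (H1 H2 : R * R -> R) : continuous H1 -> continuous H2 ->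
  (forall z, band z -> H1 z <= H2 z) -> mean t H1 <= mean t H2.
Proof.
move=> c1 c2 h12; apply: le_Rintegral_rectangle; try exact: cont_mul_fe.
by move=> z Dz; rewrite ler_wpM2r ?fe_ge0 // h12.
Qed.

Lemma meanD (t : R) (H1 H2 : R * R -> R) : continuous H1 -> continuous H2 ->
  mean t (fun z => H1 z + H2 z) = mean t H1 + mean t H2.
Proof.
move=> c1 c2; rewrite /mean -RintegralD.
- by apply: eq_Rintegral => z _; rewrite mulrDl.
- exact: measurable_rectangle.
- by apply: integrable_rectangle; exact: cont_mul_fe.
- by apply: integrable_rectangle; exact: cont_mul_fe.
Qed.

Lemma meanZ (t k : R) (H : R * R -> R) : continuous H ->
  mean t (fun z => k * H z) = k * mean t H.
Proof.
move=> cH; rewrite /mean -RintegralZl.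
- by apply: eq_Rintegral => z _; rewrite mulrA.
- exact: measurable_rectangle.
- by apply: integrable_rectangle; exact: cont_mul_fe.
Qed.

Lemma eq_mean (t : R) (H1 H2 : R * R -> R) : (forall z, band z -> H1 z = H2 z) ->
  mean t H1 = mean t H2.
Proof. by move=> h; apply: eq_Rintegral => z /set_mem Dz; rewrite h. Qed.

Local Lemma restrict_band (h : R -> R) : (forall w, M < `|w| -> h w = 0) ->
  \int[leb]_w h w = \int[leb]_(w in `[- M, M]) h w.
Proof.
move=> h0; rewrite [RHS]Rintegral_mkcond; apply: eq_Rintegral => w _.
rewrite patchE; case: ifPn => //.
rewrite notin_setE /= in_itv /= -ler_norml => /negP; rewrite -ltNge; exact: h0.
Qed.

Lemma mean_angle (t : R) (h : R -> R) : 0 <= t -> continuous h ->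
  mean t (fun z => h z.1) =
  \int[leb]_w \int[leb]_(x in period) (h x * f x w t).
Proof.
move=> t0 ch; rewrite /mean /band Rintegral_rectangle21; last first.
  by apply: cont_mul_fe; apply: continuous_comp_real; solve_continuous.
rewrite restrict_band; last first.
  move=> w Mw; apply/eqP; rewrite -[X in _ == X](mul0r (fine (leb period))).
  rewrite -(@Rintegral_cst _ _ _ leb); last exact: measurable_itv.
  by apply/eqP/eq_Rintegral => x _; rewrite support_bounded // mulr0.
apply: eq_Rintegral => w _; apply: eq_Rintegral => x _ /=.
by rewrite -/(fe _ _ _) feE.
Qed.

Lemma mean1 (t : R) : 0 <= t -> mean t (fun=> 1) = 1.
Proof.
move=> t0; rewrite (@mean_angle t (fun=> 1)) //; last by solve_continuous.
have [_ _ g1 _ _] := gP.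
transitivity (\int[leb]_w g w); last by rewrite /Rintegral g1.
apply: eq_Rintegral => w _; rewrite -(mass_conserved w t0).
by apply: eq_Rintegral => x _; rewrite mul1r.
Qed.

Lemma continuous_mean (H : R * R -> R) : continuous H ->
  continuous (fun t => mean t H).
Proof.
move=> cH; apply: (@continuous_Rintegral_rectangle _ _ _ _ _
  (fun t (z : R * R) => H z * fe z.1 z.2 t)).
apply: continuous_mul; last exact: continuous_fe.
by move=> p; apply: (@continuous_comp _ _ _ fst H); [exact: cvg_fst|exact: cH].
Qed.

Definition mean_cos (t : R) : R := mean t (fun z => cos z.1).
Definition mean_sin (t : R) : R := mean t (fun z => sin z.1).

(** The addition formula separates x from y in sin (x - y), so f enters the velocity only through
    two moments; its smoothness in x and w is then visible. *)
Lemma velocityE (x w t : R) : 0 <= t ->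
  velocity K f x w t = w - K * (mean_cos t * sin x - mean_sin t * cos x).
Proof.
move=> t0; rewrite /velocity; congr (_ - _ * _).
have cs : continuous (fun z : R * R => sin (x - z.1)).
  by apply: continuous_comp_real; solve_continuous.
transitivity (mean t (fun z => sin (x - z.1))).
  rewrite /mean /band Rintegral_rectangle12; last exact: cont_mul_fe.
  apply: eq_Rintegral => y _ /=; rewrite /density restrict_band; last first.
    by move=> u; exact: support_bounded.
  rewrite -(@RintegralZl _ _ _ leb).
  - by apply: eq_Rintegral => u _; rewrite -/(fe _ _ _) feE.
  - exact: measurable_itv.
  - have -> : (fun u => f y u t) = (fun u => fe y u t).
      by apply/funext => u; rewrite feE.
    by apply: integrable_segment; apply: cont_fe_comp; solve_continuous.
rewrite (@eq_mean _ _ (fun z => sin x * cos z.1 + - cos x * sin z.1)); last first.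
  by move=> z _; rewrite sinB mulNr.
rewrite meanD; try solve_continuous.
by rewrite !meanZ; try solve_continuous; rewrite /mean_cos /mean_sin; ring.
Qed.

(** The non-conservative form, obtained by computing the derivative of the flux in two ways. Along
    trajectories f grows at the rate K R cos (x - phi), which is what the maximum principle has to
    beat. *)
Lemma dtime_transport (x w t : R) : 0 < t ->
  dtime x w t = K * (mean_cos t * cos x + mean_sin t * sin x) * f x w t
    - velocity K f x w t * dangle x w t.
Proof.
move=> t0; have Hf := is_derive_angle x w t0.
have Hv : is_derive x 1 (fun y => velocity K f y w t)
    (- K * (mean_cos t * cos x + mean_sin t * sin x)).
  have -> : (fun y => velocity K f y w t) =
      (fun y => w - K * (mean_cos t * sin y - mean_sin t * cos y)).
    by apply/funext => y; rewrite velocityE // ltW.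
  by apply: is_derive_eq; rewrite /GRing.scale /=; ring.
have Hp := is_derive_flux x w t0.
have Hq : is_derive x 1 (fun y => velocity K f y w t * f y w t)
    (velocity K f x w t * dangle x w t + f x w t *
      (- K * (mean_cos t * cos x + mean_sin t * sin x))).
  by apply: (is_derive_eq (is_deriveM Hv Hf)); rewrite /GRing.scale /=; ring.
have := @derive_val _ _ _ _ _ _ _ Hp; rewrite (@derive_val _ _ _ _ _ _ _ Hq).
by move=> /(congr1 -%R); rewrite opprK => <-; ring.
Qed.

Local Lemma compact_band : compact band.
Proof. exact: compact_rectangle. Qed.

Lemma bounded_density (a b : R) : exists2 C : R, 0 <= C &
  forall z t, band z -> a <= t <= b -> `|f z.1 z.2 (Num.max t 0)| <= C.
Proof.
have cK : compact (band `*` `[a, b]).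
  by apply: compact_setX; [exact: compact_band|exact: segment_compact].
have [C C0 hC] := bounded_on_compact cK (continuous_subspaceT continuous_fe).
exists C => // z t Az tab; by apply: (hC (z, t)); split => //=.
Qed.

Lemma continuous_velocity (t : R) : 0 <= t ->
  continuous (fun z : R * R => velocity K f z.1 z.2 t).
Proof.
move=> t0; have -> : (fun z : R * R => velocity K f z.1 z.2 t) = (fun z =>
    z.2 - K * (mean_cos t * sin z.1 - mean_sin t * cos z.1)).
  by apply/funext => z; rewrite velocityE.
solve_continuous.
Qed.

(** The weak form of the equation for a test function of angle and time; the bounds by C near t0
    provide the domination for differentiating under the integral. *)
Lemma is_derive_mean (h ht : R -> R -> R) (hx : R -> R) (t0 e C : R) :
  0 < t0 -> 0 < e ->
  (forall t, `|t - t0| < e -> continuous (h^~ t)) ->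
  (forall x t : R, `|t - t0| < e -> is_derive t 1 (h x) (ht x t)) ->
  (forall x t, `|t - t0| < e -> `|h x t| <= C) ->
  (forall x t, `|t - t0| < e -> `|ht x t| <= C) ->
  periodic (h^~ t0) (pi *+ 2) ->
  (forall x : R, is_derive x 1 (h^~ t0) (hx x)) ->
  continuous hx -> continuous (ht^~ t0) ->
  is_derive t0 1 (fun t => mean t (fun z => h z.1 t))
    (mean t0 (fun z => ht z.1 t0 + velocity K f z.1 z.2 t0 * hx z.1)).
Proof.
move=> t00 e0 ch dht bh bht ph dhx chx cht.
have [Cf Cf0 hCf] := bounded_density (t0 - t0 / 2) (t0 + t0 / 2).
have [Cd hCd] := dtime_bounded compact_band t00.
pose e' := Num.min e (t0 / 2).
have e'0 : 0 < e' by rewrite lt_min e0 divr_gt0.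
have e'P t : `|t - t0| < e' -> `|t - t0| < e /\ `|t - t0| < t0 / 2.
  by rewrite lt_min => /andP.
have C0 : 0 <= C.
  by apply: le_trans (bh 0 t0 _); rewrite ?subrr ?normr0.
pose G (t : R) (z : R * R) := ht z.1 t * fe z.1 z.2 t + h z.1 t * dtime z.1 z.2 t.
have D : is_derive t0 1 (fun t => mean t (fun z => h z.1 t))
    (\int[leb2]_(z in band) G t0 z).
  apply: (@is_derive_Rintegral_rectangle _ _ _ _ _
    (fun t (z : R * R) => h z.1 t * fe z.1 z.2 t) G t0 e' (C * Cf + C * Cd)) => //.
  - move=> t /e'P[te _]; apply: cont_mul_fe.
    apply: (@continuous_comp_real _ _ (h^~ t) fst); first exact: ch.
    by move=> z; exact: cvg_fst.
  - move=> t z /e'P[te /ltW]; rewrite ler_norml => tt _.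
    have H1 := dht z.1 t te.
    have H2 : is_derive t 1 (fe z.1 z.2) (dtime z.1 z.2 t).
      by apply: is_derive_fe; lra.
    apply: (is_derive_eq (is_deriveM H1 H2)); rewrite /GRing.scale /= /G; ring.
  - move=> t z /e'P[te tt] Dz.
    apply: le_trans (ler_normD _ _) _; rewrite !normrM; apply: lerD.
      apply: ler_pM => //; first exact: bht.
      by apply: hCf => //; move: tt; rewrite ltr_norml; lra.
    by apply: ler_pM => //; [exact: bh | apply: hCd => //; exact: ltW].
apply: (is_derive_eq D).
have c1 : continuous (fun z : R * R => ht z.1 t0).
  apply: (@continuous_comp_real _ _ (ht^~ t0) fst); first exact: cht.
  by move=> z; exact: cvg_fst.
have c2 : continuous (fun z : R * R => hx z.1).
  apply: (@continuous_comp_real _ _ hx fst); first exact: chx.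
  by move=> z; exact: cvg_fst.
have c3 : continuous (fun z : R * R => h z.1 t0).
  apply: (@continuous_comp_real _ _ (h^~ t0) fst).
    by apply: ch; rewrite subrr normr0.
  by move=> z; exact: cvg_fst.
have c4 := continuous_velocity (ltW t00).
have c5 := continuous_dtime_slice t00.
have c6 := @continuous_fe_slice t0.
(* V is the x-derivative of h times the flux, so it integrates to zero over a period; adding it
   replaces the term in [dtime] by the transport term. *)
pose V (z : R * R) := velocity K f z.1 z.2 t0 * hx z.1 * fe z.1 z.2 t0
  - h z.1 t0 * dtime z.1 z.2 t0.
have cV : continuous V by rewrite /V; solve_continuous.
have cG : continuous (G t0) by rewrite /G; solve_continuous.
have V0 : \int[leb2]_(z in band) V z = 0.
  rewrite /band Rintegral_rectangle21 // -[RHS](mul0r (fine (leb `[- M, M]))).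
  rewrite -(@Rintegral_cst _ _ _ leb); last exact: measurable_itv.
  apply: eq_Rintegral => w _.
  apply: (@Rintegral_period_derive _
    (fun y => h y t0 * (velocity K f y w t0 * f y w t0))
    (fun x => V (x, w))).
  - move=> x; rewrite [h _ _]ph [velocity _ _ _ _ _]velocity_periodic.
    by have [[H _ _ _ _] _] := fP; congr (_ * (_ * _)); apply: H; rewrite ltW.
  - move=> x; have H1 := dhx x; have H2 := is_derive_flux x w t00.
    apply: (is_derive_eq (is_deriveM H1 H2)); rewrite /GRing.scale /= /V /=.
    by rewrite feE ?(ltW t00) //; ring.
  - exact: (@continuous_slice1 _ V w cV).
rewrite -[LHS]addr0 -V0 -RintegralD.
- apply: eq_Rintegral => z _; rewrite /G /V /= -/(fe _ _ _); ring.
- exact: measurable_rectangle.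
- exact: integrable_rectangle.
- exact: integrable_rectangle.
Qed.

(** * The frame rotating with the mean phase *)

Definition radius (t : R) : R := Num.sqrt (mean_cos t ^+ 2 + mean_sin t ^+ 2).
(** This and [relsin] are cos (x - phi) and sin (x - phi), expressed by the moments so that no
    choice of phi is involved. *)
Definition relcos (x t : R) : R :=
  (mean_cos t * cos x + mean_sin t * sin x) / radius t.
Definition relsin (x t : R) : R :=
  (mean_cos t * sin x - mean_sin t * cos x) / radius t.
Definition dmean_cos (t : R) : R :=
  mean t (fun z => 0 + velocity K f z.1 z.2 t * - sin z.1).
Definition dmean_sin (t : R) : R :=
  mean t (fun z => 0 + velocity K f z.1 z.2 t * cos z.1).
(* The derivative of the mean phase, without choosing a differentiable lift. *)
Definition spin (t : R) : R :=
  (mean_cos t * dmean_sin t - mean_sin t * dmean_cos t) / radius t ^+ 2.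

Let cont_cos1 : continuous (fun z : R * R => cos z.1).
Proof. solve_continuous. Qed.

Let cont_sin1 : continuous (fun z : R * R => sin z.1).
Proof. solve_continuous. Qed.

Lemma radius_sqr t : radius t ^+ 2 = mean_cos t ^+ 2 + mean_sin t ^+ 2.
Proof. by rewrite sqr_sqrtr // addr_ge0 // sqr_ge0. Qed.

Lemma continuous_mean_cos : continuous mean_cos.
Proof. by apply: continuous_mean. Qed.

Lemma continuous_mean_sin : continuous mean_sin.
Proof. by apply: continuous_mean. Qed.

Lemma continuous_radius : continuous radius.
Proof.
apply: continuous_comp_real; first exact: sqrt_continuous.
have c1 := continuous_mean_cos; have c2 := continuous_mean_sin.
have -> : (fun t => mean_cos t ^+ 2 + mean_sin t ^+ 2) =
  (fun t => mean_cos t * mean_cos t + mean_sin t * mean_sin t).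
  by apply/funext => t; rewrite !expr2.
by apply: continuous_add; apply: continuous_mul.
Qed.

Lemma is_derive_mean_cos (t : R) : 0 < t -> is_derive t 1 mean_cos (dmean_cos t).
Proof.
move=> t0; apply: (@is_derive_mean (fun x _ => cos x) (fun _ _ => 0)
  (fun x => - sin x) t 1 1) => //.
- by move=> s _; exact: continuous_cos.
- by move=> x s _; exact: cos_max.
- by move=> _ s _; rewrite normr0.
- exact: cosD2pi.
- by solve_continuous.
- by solve_continuous.
Qed.

Lemma is_derive_mean_sin (t : R) : 0 < t -> is_derive t 1 mean_sin (dmean_sin t).
Proof.
move=> t0; apply: (@is_derive_mean (fun x _ => sin x) (fun _ _ => 0)
  (fun x => cos x) t 1 1) => //.
- by move=> s _; exact: continuous_sin.
- by move=> x s _; exact: sin_max.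
- by move=> _ s _; rewrite normr0.
- exact: sinD2pi.
- by solve_continuous.
- by solve_continuous.
Qed.

Lemma is_derive_radius (t : R) : 0 < t -> 0 < radius t ->
  is_derive t 1 radius
    ((mean_cos t * dmean_cos t + mean_sin t * dmean_sin t) / radius t).
Proof.
move=> t0 r0; have H1 := is_derive_mean_cos t0; have H2 := is_derive_mean_sin t0.
have p0 : 0 < mean_cos t ^+ 2 + mean_sin t ^+ 2.
  by rewrite -radius_sqr exprn_gt0.
have H3 : is_derive t 1 (fun t => mean_cos t ^+ 2 + mean_sin t ^+ 2)
  (2 * (mean_cos t * dmean_cos t + mean_sin t * dmean_sin t)).
  by apply: is_derive_eq; rewrite /GRing.scale /=; ring.
have H4 := is_derive1_sqrt p0.
apply: (is_derive_eq (@is_derive1_comp _ Num.sqrt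
  (fun t => mean_cos t ^+ 2 + mean_sin t ^+ 2) t _ _ H4 H3)).
by rewrite -/(radius t) /GRing.scale /=; field; rewrite gt_eqF.
Qed.

Lemma relcos_sqr x t : 0 < radius t -> relcos x t ^+ 2 + relsin x t ^+ 2 = 1.
Proof.
move=> r0; rewrite /relcos /relsin.
have r2 := radius_sqr t; have cs := cos2Dsin2 x.
rewrite !expr_div_n -mulrDl; apply: (canLR (mulfK _)); rewrite ?mul1r.
  by rewrite expf_neq0 // gt_eqF.
rewrite r2 -[RHS]mulr1 -cs; ring.
Qed.

Lemma relcos_le1 x t : 0 < radius t -> `|relcos x t| <= 1.
Proof.
move=> /relcos_sqr => /(_ x) h; rewrite -(@ler_pXn2r _ 2) ?nnegrE //.
by rewrite real_normK ?num_real // expr1n -h lerDl sqr_ge0.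
Qed.

Lemma relsin_le1 x t : 0 < radius t -> `|relsin x t| <= 1.
Proof.
move=> /relcos_sqr => /(_ x) h; rewrite -(@ler_pXn2r _ 2) ?nnegrE //.
by rewrite real_normK ?num_real // expr1n -h lerDr sqr_ge0.
Qed.

Lemma relcos_periodic t : periodic (relcos^~ t) (pi *+ 2).
Proof. by move=> x; rewrite /relcos cosD2pi sinD2pi. Qed.

Lemma continuous_relcos t : continuous (relcos^~ t).
Proof. by rewrite /relcos; solve_continuous. Qed.

Lemma continuous_relsin t : continuous (relsin^~ t).
Proof. by rewrite /relsin; solve_continuous. Qed.

Lemma is_derive_relcos_angle (x t : R) :
  is_derive x 1 (relcos^~ t) (- relsin x t).
Proof. by rewrite /relcos; apply: is_derive_eq; rewrite /relsin /GRing.scale /=; ring. Qed.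

Lemma is_derive_relcos_time (x t : R) : 0 < t -> 0 < radius t ->
  is_derive t 1 (relcos x) (relsin x t * spin t).
Proof.
move=> t0 r0; have H1 := is_derive_mean_cos t0; have H2 := is_derive_mean_sin t0.
have H3 := is_derive_radius t0 r0; have rN : radius t != 0 by rewrite gt_eqF.
have H4 := is_deriveV rN H3.
have H5 : is_derive t 1 (fun t => mean_cos t * cos x + mean_sin t * sin x)
    (dmean_cos t * cos x + dmean_sin t * sin x).
  by apply: is_derive_eq; rewrite /GRing.scale /=; ring.
apply: (is_derive_eq (is_deriveM H5 H4)); rewrite /GRing.scale /=.
have r2 := radius_sqr t; rewrite /relsin /spin -exprVn.
set i := (radius t)^-1; set a := mean_cos t; set b := mean_sin t.
set u := dmean_cos t; set v := dmean_sin t.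
have ri : (a ^+ 2 + b ^+ 2) * i ^+ 2 = 1.
  by rewrite /a /b -r2 /i exprVn divff // expf_neq0.
(* Inserting the factor (a^2 + b^2) i^2 = 1 makes every term cubic in i, after which the identity is
   polynomial. *)
have -> : i * (u * cos x + v * sin x) =
    i * (u * cos x + v * sin x) * ((a ^+ 2 + b ^+ 2) * i ^+ 2).
  by rewrite ri mulr1.
by ring.
Qed.

Lemma velocity_rel (x w t : R) : 0 <= t -> 0 < radius t ->
  velocity K f x w t = w - K * radius t * relsin x t.
Proof.
by move=> t0 r0; rewrite velocityE // /relsin; field; rewrite gt_eqF.
Qed.

Lemma norm_mean_le (t B : R) (H : R * R -> R) : 0 <= t -> continuous H ->
  (forall z, band z -> `|H z| <= B) -> `|mean t H| <= B.
Proof.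
move=> t0 cH HB.
have c1 k : continuous (fun _ : R * R => k * 1 : R) by solve_continuous.
have c2 : continuous (fun _ : R * R => 1 : R) by solve_continuous.
have := le_mean t cH (c1 B); have := le_mean t (c1 (- B)) cH.
rewrite !meanZ // !mean1 // !mulr1 => l u.
by rewrite ler_norml l ?u // => z /HB; rewrite ler_norml => /andP[].
Qed.

(** Near t0 the radius stays above half its value and velocities are bounded on [band]. This
    dominates the time derivative of functions of [relcos]. *)
Local Lemma spin_bounded (t0 : R) : 0 < t0 -> 0 < radius t0 ->
  exists e C : R, [/\ 0 < e, e <= t0, 0 <= C &
    forall t, `|t - t0| < e -> 0 < radius t /\ `|spin t| <= C].
Proof.
move=> t00 r0.
have [h h0 hh] := continuous_at_dist (@continuous_radius t0) (ltac:(lra) : 0 < radius t0 / 2).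
have mc (t : R) : 0 <= t -> `|mean_cos t| <= 1.
  by move=> tt; apply: norm_mean_le => // z _; exact: cos_max.
have ms (t : R) : 0 <= t -> `|mean_sin t| <= 1.
  by move=> tt; apply: norm_mean_le => // z _; exact: sin_max.
pose B := M + `|K| * 2.
have B0 : 0 <= B by rewrite addr_ge0 ?mulr_ge0 // ltW.
have vB (t : R) z : 0 <= t -> band z -> `|velocity K f z.1 z.2 t| <= B.
  move=> tt [_ /=]; rewrite in_itv /= -ler_norml => zM; rewrite velocityE //.
  apply: le_trans (ler_normB _ _) _; apply: lerD => //.
  rewrite normrM ler_wpM2l //; apply: le_trans (ler_normB _ _) _.
  rewrite !normrM; apply: (@le_trans _ _ (1 * 1 + 1 * 1)); last by lra.
  apply: lerD; apply: ler_pM => //.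
  - exact: mc.
  - exact: sin_max.
  - exact: ms.
  - exact: cos_max.
have dc (t : R) : 0 <= t -> `|dmean_cos t| <= B.
  move=> tt; have cv := continuous_velocity tt.
  apply: norm_mean_le => //; first solve_continuous.
  move=> z Dz; rewrite add0r normrM normrN -[B]mulr1.
  by apply: ler_pM => //; [exact: vB | exact: sin_max].
have ds (t : R) : 0 <= t -> `|dmean_sin t| <= B.
  move=> tt; have cv := continuous_velocity tt.
  apply: norm_mean_le => //; first solve_continuous.
  move=> z Dz; rewrite add0r normrM -[B]mulr1.
  by apply: ler_pM => //; [exact: vB | exact: cos_max].
pose i := (radius t0 / 2)^-1.
exists (Num.min h t0), ((B + B) * i ^+ 2); split.
- by rewrite lt_min h0.
- by rewrite ge_min lexx orbT.
- by apply: mulr_ge0; [exact: addr_ge0 | exact: sqr_ge0].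
move=> t; rewrite lt_min => /andP[/hh]; rewrite !ltr_norml => rt tt.
have {}tt : 0 <= t by lra.
have rt0 : radius t0 / 2 <= radius t by lra.
have rt1 : 0 < radius t by lra.
split=> //; rewrite /spin normrM; apply: ler_pM => //.
  apply: le_trans (ler_normB _ _) _; rewrite !normrM -[B]mul1r.
  by apply: lerD; apply: ler_pM => //; [exact: mc|exact: ds|exact: ms|exact: dc].
rewrite ger0_norm ?invr_ge0 ?sqr_ge0 // -exprVn ler_pXn2r ?nnegrE ?invr_ge0 //; last 2 first.
- exact: ltW.
- by rewrite ltW // divr_gt0.
by rewrite lef_pV2 // posrE divr_gt0.
Qed.

(** In the rotating frame an oscillator moves at speed [velocity - spin], and the chain rule
    contributes minus the sine. Applied to 1 - c^2 for [spread] and to [step] for [clustering]. *)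
Lemma is_derive_profile (psi dpsi : R -> R) (t0 : R) :
  0 < t0 -> 0 < radius t0 ->
  (forall c : R, is_derive c 1 psi (dpsi c)) -> continuous dpsi ->
  is_derive t0 1 (fun t => mean t (fun z => psi (relcos z.1 t)))
    (mean t0 (fun z => - (dpsi (relcos z.1 t0) * relsin z.1 t0 *
      (velocity K f z.1 z.2 t0 - spin t0)))).
Proof.
move=> t00 r0 dP cdpsi.
have cpsi : continuous psi := fun c => is_derive_continuous (dP c).
have [e [C [e0 et C0 eP]]] := spin_bounded t00 r0.
have c11 : compact (`[-1, 1] : set R) by exact: segment_compact.
have [C1' C10 hC1] := bounded_on_compact c11 (continuous_subspaceT cpsi).
have [C2 C20 hC2] := bounded_on_compact c11 (continuous_subspaceT cdpsi).
have in11 x t : `|t - t0| < e -> `[-1, 1]%classic (relcos x t).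
  move=> /eP[rt _]; rewrite /= in_itv /= -ler_norml; exact: relcos_le1.
have tpos t : `|t - t0| < e -> 0 < t by rewrite ltr_norml; lra.
have t0e : `|t0 - t0| < e by rewrite subrr normr0.
have D := @is_derive_mean (fun x t => psi (relcos x t))
  (fun x t => dpsi (relcos x t) * (relsin x t * spin t))
  (fun x => dpsi (relcos x t0) * - relsin x t0) t0 e (C1' + C2 * (1 * C)) t00 e0.
apply: (is_derive_eq (D _ _ _ _ _ _ _ _)).
- move=> t _; apply: continuous_comp_real => //; exact: continuous_relcos.
- move=> x t te; have [rt _] := eP t te.
  have H := is_derive_relcos_time x (tpos t te) rt.
  exact: (@is_derive1_comp _ psi (relcos x) t _ _ (dP _) H).
- move=> x t te; apply: le_trans (hC1 _ (in11 x t te)) _.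
  by rewrite lerDl mulr_ge0 // mul1r.
- move=> x t te; have [rt sp] := eP t te; rewrite -[X in X <= _]add0r.
  apply: lerD => //; rewrite normrM; apply: ler_pM => //.
    exact: hC2 (in11 x t te).
  rewrite (normrM (relsin x t)); apply: ler_pM => //; exact: relsin_le1.
- by move=> x; rewrite /= relcos_periodic.
- move=> x; exact: (@is_derive1_comp _ psi (relcos^~ t0) x _ _ (dP _)
    (is_derive_relcos_angle x t0)).
- have c1 := @continuous_relcos t0; have c2 := @continuous_relsin t0.
  apply: continuous_mul; last by solve_continuous.
  by apply: (@continuous_comp_real _ _ dpsi).
- have c1 := @continuous_relcos t0; have c2 := @continuous_relsin t0.
  apply: continuous_mul; last by solve_continuous.
  by apply: (@continuous_comp_real _ _ dpsi).
by apply: eq_mean => z _; ring.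
Qed.

Hypothesis K0 : 0 < K.

(** Small exactly when the mass sits near phi or near its antipode; telling the two apart is left to
    [radius] and [clustering]. *)
Definition spread (t : R) : R := mean t (fun z => relsin z.1 t ^+ 2).
Definition dradius (t : R) : R :=
  K * radius t * spread t - mean t (fun z => z.2 * relsin z.1 t).
Definition dspread (t : R) : R :=
  mean t (fun z => 2 * (relcos z.1 t * relsin z.1 t *
    (velocity K f z.1 z.2 t - spin t))).

Section FixedTime.
Variable t : R.
Hypotheses (t0 : 0 <= t) (r0 : 0 < radius t).

Let cc : continuous (fun z : R * R => relcos z.1 t).
Proof.
apply: (@continuous_comp_real _ _ (relcos^~ t)); first exact: continuous_relcos.
by move=> ?; exact: cvg_fst.
Qed.

Let cs : continuous (fun z : R * R => relsin z.1 t).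
Proof.
apply: (@continuous_comp_real _ _ (relsin^~ t)); first exact: continuous_relsin.
by move=> ?; exact: cvg_fst.
Qed.

Let cv : continuous (fun z : R * R => velocity K f z.1 z.2 t).
Proof. exact: continuous_velocity. Qed.

Let c2 : continuous (fun z : R * R => z.2).
Proof. by move=> ?; exact: cvg_snd. Qed.

Lemma mean_relcos : mean t (fun z => relcos z.1 t) = radius t.
Proof.
rewrite (@eq_mean _ _ (fun z => mean_cos t / radius t * cos z.1 +
    mean_sin t / radius t * sin z.1)); last first.
  by move=> z _; rewrite /relcos; ring.
rewrite meanD; [|solve_continuous|solve_continuous].
rewrite !meanZ // -/(mean_cos t) -/(mean_sin t).
transitivity (radius t ^+ 2 / radius t); first by rewrite radius_sqr; ring.
by field; rewrite gt_eqF.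
Qed.

Lemma mean_relsin : mean t (fun z => relsin z.1 t) = 0.
Proof.
rewrite (@eq_mean _ _ (fun z => mean_cos t / radius t * sin z.1 +
    - mean_sin t / radius t * cos z.1)); last first.
  by move=> z _; rewrite /relsin; ring.
rewrite meanD; [|solve_continuous|solve_continuous].
by rewrite !meanZ // -/(mean_cos t) -/(mean_sin t); ring.
Qed.

Lemma spread_ge0 : 0 <= spread t.
Proof.
have c0 : continuous (fun z : R * R => 0 * relcos z.1 t) by solve_continuous.
have := @le_mean t _ (fun z => relsin z.1 t ^+ 2) c0.
rewrite meanZ // mul0r; apply; first solve_continuous.
by move=> z _; rewrite mul0r sqr_ge0.
Qed.

(** Cauchy-Schwarz for a probability measure, from the parametric inequality [young] at its optimal
    parameter k = q. *)
Lemma norm_mean_le_spread (B : R) (H : R * R -> R) : 0 <= B -> continuous H ->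
  (forall z, band z -> `|H z| <= B * `|relsin z.1 t|) ->
  `|mean t H| <= B * Num.sqrt (spread t).
Proof.
move=> B0 cH HB; have S0 := spread_ge0; set q := Num.sqrt _.
have qS : spread t = q ^+ 2 by rewrite sqr_sqrtr.
(* AM-GM: [2 |s| <= s ^ 2 / k + k] *)
have young k : 0 < k -> `|mean t H| <= B / 2 * (q ^+ 2 / k + k).
  move=> k0.
  have cU (s : R) : continuous (fun z : R * R => s * (relsin z.1 t ^+ 2) + s * k ^+ 2).
    by solve_continuous.
  have mU s : mean t (fun z : R * R => s * (relsin z.1 t ^+ 2) + s * k ^+ 2) =
      s * (q ^+ 2 + k ^+ 2).
    rewrite meanD; try solve_continuous.
    rewrite (@eq_mean _ (fun=> s * k ^+ 2) (fun=> (s * k ^+ 2) * 1)); last first.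
      by move=> z _; rewrite mulr1.
    by rewrite !meanZ ?mean1 // -?qS /spread; try solve_continuous; ring.
  have bd z : band z -> `|H z| <=
      B / (2 * k) * relsin z.1 t ^+ 2 + B / (2 * k) * k ^+ 2.
    move=> /HB; move/le_trans; apply.
    rewrite -mulrDr -mulrA; apply: ler_wpM2l => //.
    rewrite mulrC ler_pdivlMr ?mulr_gt0 //.
    have := sqr_ge0 (`|relsin z.1 t| - k); rewrite sqrrB real_normK ?num_real //.
    by rewrite -[_ *+ 2]mulr_natr; lra.
  have E : B / 2 * (q ^+ 2 / k + k) = B / (2 * k) * (q ^+ 2 + k ^+ 2).
    by field; rewrite gt_eqF.
  rewrite ler_norml E; apply/andP; split.
    rewrite -mulNr -mU; apply: le_mean => // z /bd; rewrite ler_norml => /andP[+ _].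
    by apply: le_trans; rewrite opprD !mulNr.
  rewrite -mU; apply: le_mean => // z /bd.
  by rewrite ler_norml => /andP[_].
have q0 : 0 <= q by exact: sqrtr_ge0.
have [q_gt0|q_le0] := ltP 0 q.
  apply: le_trans (young q q_gt0) _.
  rewrite (_ : B / 2 * _ = B * q) //; by field; rewrite gt_eqF.
have q00 : q = 0 by apply/eqP; rewrite eq_le q_le0.
rewrite q00 mulr0 leNgt; apply/negP => a0.
have B1 : 0 < B + 1 by lra.
(* For q = 0 no optimal k exists. Taking k as the mean's absolute value over B + 1 bounds that value
   by less than half of itself. *)
have := young _ (divr_gt0 a0 B1); rewrite q00 expr0n /= mul0r add0r.
rewrite leNgt => /negP; apply.
rewrite mulrA ltr_pdivrMr // [X in _ < X]mulrC ltr_pM2r //; lra.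
Qed.

Lemma mean_sin_cos_le_spread :
  `|mean t (fun z => relsin z.1 t * relcos z.1 t)| <= Num.sqrt (spread t).
Proof.
rewrite -[X in _ <= X]mul1r; apply: norm_mean_le_spread => //.
  by solve_continuous.
by move=> z _; rewrite normrM mulrC ler_wpM2r // relcos_le1.
Qed.

(** Average (1 - c) (1 + k s) >= 0, valid for |k| <= 1, with E[s] = 0 and E[c] = R, then take k = 1
    and k = -1. This bound is sharp near full synchronisation and produces the term (1 - R) / R in
    the width of the arc. *)
Lemma mean_sin_cos_le_radius :
  `|mean t (fun z => relsin z.1 t * relcos z.1 t)| <= 1 - radius t.
Proof.
have H (s : R) : `|s| <= 1 ->
    s * mean t (fun z => relsin z.1 t * relcos z.1 t) <= 1 - radius t.
  move=> s1.
  have csc : continuous (fun z : R * R => relsin z.1 t * relcos z.1 t).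
    by solve_continuous.
  have e1 : mean t (fun z => s * (relsin z.1 t * relcos z.1 t) + relcos z.1 t) =
      s * mean t (fun z => relsin z.1 t * relcos z.1 t) + radius t.
    by rewrite meanD; [rewrite meanZ // mean_relcos|solve_continuous|].
  have e2 : mean t (fun z => 1 + s * relsin z.1 t) = 1.
    rewrite meanD; [|solve_continuous|solve_continuous].
    by rewrite mean1 // meanZ // mean_relsin mulr0 addr0.
  rewrite lerBrDr -e1 -[X in _ <= X]e2.
  apply: le_mean; [solve_continuous|solve_continuous|].
  move=> z _; have := relsin_le1 z.1 r0; have := relcos_le1 z.1 r0.
  rewrite !ler_norml => /andP[c_ge c_le] /andP[s_ge s_le].
  have : `|s * relsin z.1 t| <= 1.
    by rewrite normrM mulr_ile1 // relsin_le1.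
  rewrite ler_norml => /andP[ss_ge _].
  have c0 : 0 <= 1 - relcos z.1 t by lra.
  have ss : 0 <= 1 + s * relsin z.1 t by lra.
  by have := mulr_ge0 c0 ss; lra.
rewrite ler_norml; apply/andP; split.
  by rewrite lerNl -mulN1r; apply: H; rewrite normrN normr1.
by rewrite -[X in X <= _]mul1r; apply: H; rewrite normr1.
Qed.

Lemma radius_le1 : radius t <= 1.
Proof.
rewrite -mean_relcos -(mean1 t0); apply: le_mean; [solve_continuous..|].
by move=> z _; have := relcos_le1 z.1 r0; rewrite ler_norml => /andP[].
Qed.

Let cvc : continuous (fun z : R * R => velocity K f z.1 z.2 t * cos z.1).
Proof. solve_continuous. Qed.

Let cvs : continuous (fun z : R * R => velocity K f z.1 z.2 t * sin z.1).
Proof. solve_continuous. Qed.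

Local Lemma dmean_sinE :
  dmean_sin t = mean t (fun z => velocity K f z.1 z.2 t * cos z.1).
Proof. by apply: eq_mean => z _; rewrite add0r. Qed.

Local Lemma dmean_cosE :
  dmean_cos t = - mean t (fun z => velocity K f z.1 z.2 t * sin z.1).
Proof.
rewrite -mulN1r -meanZ //; apply: eq_mean => z _; ring.
Qed.

Lemma radius_spin : radius t * spin t =
  mean t (fun z => relcos z.1 t * z.2)
  - K * radius t * mean t (fun z => relsin z.1 t * relcos z.1 t).
Proof.
have c1 : continuous (fun z : R * R => relcos z.1 t * z.2) by solve_continuous.
have c3 : continuous (fun z : R * R => relsin z.1 t * relcos z.1 t).
  by solve_continuous.
transitivity (mean t (fun z => velocity K f z.1 z.2 t * relcos z.1 t)).
  rewrite /spin dmean_sinE dmean_cosE.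
  rewrite (@eq_mean _ (fun z => velocity K f z.1 z.2 t * relcos z.1 t)
    (fun z => mean_cos t / radius t * (velocity K f z.1 z.2 t * cos z.1) +
      mean_sin t / radius t * (velocity K f z.1 z.2 t * sin z.1))); last first.
    by move=> z _; rewrite /relcos; ring.
  rewrite meanD; [|solve_continuous|solve_continuous].
  by rewrite !meanZ //; field; rewrite gt_eqF.
rewrite (@eq_mean _ _ (fun z => relcos z.1 t * z.2 +
    - (K * radius t) * (relsin z.1 t * relcos z.1 t))); last first.
  by move=> z _; rewrite velocity_rel //; ring.
rewrite meanD; [|solve_continuous|solve_continuous].
by rewrite meanZ //; ring.
Qed.

Local Lemma band_frequency z : band z -> `|z.2| <= M.
Proof. by case=> _ /=; rewrite in_itv /= -ler_norml. Qed.

Lemma radius_spin_le (B : R) :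
  `|mean t (fun z => relsin z.1 t * relcos z.1 t)| <= B ->
  radius t * `|spin t| <= M + K * radius t * B.
Proof.
move=> hB; have Kr : 0 <= K * radius t by rewrite mulr_ge0 // ltW.
rewrite -[X in X * _](gtr0_norm r0) -normrM radius_spin.
apply: le_trans (ler_normB _ _) _; apply: lerD.
  apply: norm_mean_le => //; first solve_continuous.
  move=> z /band_frequency zM; rewrite normrM -[M]mul1r.
  by apply: ler_pM => //; exact: relcos_le1.
by rewrite normrM (ger0_norm Kr) ler_wpM2l.
Qed.

Lemma forcing_le : `|mean t (fun z => z.2 * relsin z.1 t)| <= M * Num.sqrt (spread t).
Proof.
apply: norm_mean_le_spread; [exact: ltW|solve_continuous|].
by move=> z /band_frequency zM; rewrite normrM ler_wpM2r.
Qed.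

Lemma dspread_le : `|dspread t| <= 2 * (M * Num.sqrt (spread t) +
  K * radius t * spread t + `|spin t| * Num.sqrt (spread t)).
Proof.
have Kr : 0 <= K * radius t by rewrite mulr_ge0 // ltW.
have c1 : continuous (fun z : R * R => relcos z.1 t * relsin z.1 t * z.2).
  by solve_continuous.
have c3 : continuous (fun z : R * R => relcos z.1 t * relsin z.1 t ^+ 2).
  by solve_continuous.
have c4 : continuous (fun z : R * R => relsin z.1 t * relcos z.1 t).
  by solve_continuous.
have -> : dspread t = 2 * mean t (fun z => relcos z.1 t * relsin z.1 t * z.2)
    + (- (2 * (K * radius t)) * mean t (fun z => relcos z.1 t * relsin z.1 t ^+ 2)
    + (- (2 * spin t)) * mean t (fun z => relsin z.1 t * relcos z.1 t)).
  rewrite -!meanZ // -meanD; [|solve_continuous|solve_continuous].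
  rewrite -meanD; [|solve_continuous|solve_continuous].
  by apply: eq_mean => z _; rewrite velocity_rel //; ring.
apply: le_trans (ler_normD _ _) _; rewrite !mulrDr -addrA; apply: lerD.
  rewrite normrM ger0_norm // ler_wpM2l //.
  apply: norm_mean_le_spread; [exact: ltW|solve_continuous|].
  move=> z /band_frequency zM; rewrite normrM mulrC; apply: ler_pM => //.
  by rewrite normrM ler_piMl // relcos_le1.
apply: le_trans (ler_normD _ _) _; apply: lerD.
  have Kr2 : 0 <= 2 * (K * radius t) by rewrite mulr_ge0.
  rewrite normrM normrN (ger0_norm Kr2) [X in _ <= X]mulrA; apply: ler_wpM2l => //.
  rewrite ler_norml /spread -mulN1r -meanZ; last by solve_continuous.
  apply/andP; split; (apply: le_mean; [solve_continuous..|]);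
    move=> z _; have := relcos_le1 z.1 r0; rewrite ler_norml => /andP[l u].
    by rewrite ler_wpM2r // sqr_ge0.
  by rewrite -[X in _ <= X]mul1r ler_wpM2r // sqr_ge0.
have n2 : `|2 : R| = 2 by rewrite ger0_norm.
rewrite normrM normrN normrM n2 [X in _ <= X]mulrA.
by apply: ler_wpM2l; [rewrite mulr_ge0 | exact: mean_sin_cos_le_spread].
Qed.

Lemma is_derive_dradius : 0 < t -> is_derive t 1 radius (dradius t).
Proof.
move=> tt; apply: (is_derive_eq (is_derive_radius tt r0)).
have c1 : continuous (fun z : R * R => z.2 * relsin z.1 t) by solve_continuous.
have c3 : continuous (fun z : R * R => relsin z.1 t ^+ 2) by solve_continuous.
have -> : dradius t = mean t (fun z => K * radius t * relsin z.1 t ^+ 2 +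
    -1 * (z.2 * relsin z.1 t)).
  rewrite meanD; [|solve_continuous|solve_continuous].
  by rewrite !meanZ // mulN1r.
transitivity (mean t (fun z => - mean_cos t / radius t *
    (velocity K f z.1 z.2 t * sin z.1) + mean_sin t / radius t *
    (velocity K f z.1 z.2 t * cos z.1))).
  rewrite meanD; [|solve_continuous|solve_continuous].
  by rewrite !meanZ // dmean_sinE dmean_cosE; ring.
apply: eq_mean => z _.
transitivity (- (velocity K f z.1 z.2 t * relsin z.1 t)).
  by rewrite /relsin; ring.
by rewrite velocity_rel //; ring.
Qed.

Lemma is_derive_spread : 0 < t -> is_derive t 1 spread (dspread t).
Proof.
move=> tt.
(* The squared sine becomes the profile 1 - c^2. This fails at radius zero, where division makes
   both [relcos] and [relsin] vanish, so the two means are compared only near t. *)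
have H (c : R) : is_derive c 1 (fun c => 1 - c ^+ 2) (- (2 * c)).
  by apply: is_derive_eq; rewrite /GRing.scale /=; ring.
have cH : continuous (fun c : R => - (2 * c)) by solve_continuous.
have D := is_derive_profile tt r0 H cH.
have E : mean t (fun z => - (- (2 * relcos z.1 t) * relsin z.1 t *
    (velocity K f z.1 z.2 t - spin t))) = dspread t.
  by apply: eq_mean => z _; ring.
rewrite -E; apply: near_eq_is_derive D; near=> u.
apply: eq_mean => z _; apply/eqP; rewrite subr_eq addrC relcos_sqr //.
by near: u; apply: (cvgr_gt (radius t)) => //; exact: continuous_radius.
Unshelve. all: by end_near. Qed.

End FixedTime.

(* Then the arc |sin (x - phi)| <= s0, cos (x - phi) > 0 is a trap: on its
   boundary every oscillator moves inwards relatively to the mean phase. *)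
Definition trapped (s0 t : R) : Prop :=
  M + `|spin t| <= K * radius t * s0.

Local Lemma trap_pushes (s0 t : R) z : 0 < s0 -> 0 <= t -> 0 < radius t -> trapped s0 t ->
  band z -> s0 <= `|relsin z.1 t| ->
  relsin z.1 t * (velocity K f z.1 z.2 t - spin t) <= 0.
Proof.
move=> s00 t0 r0 tr [_ /=]; rewrite in_itv /= -ler_norml => zM ss.
rewrite velocity_rel //.
set s := relsin z.1 t in ss *; have s2 : s ^+ 2 = `|s| ^+ 2.
  by rewrite real_normK ?num_real.
have -> : s * (z.2 - K * radius t * s - spin t) =
    s * (z.2 - spin t) - K * radius t * `|s| ^+ 2 by rewrite -s2; ring.
rewrite subr_le0; apply: le_trans (ler_norm _) _; rewrite normrM.
have kr : 0 <= K * radius t by rewrite mulr_ge0 // ltW.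
rewrite [X in _ <= X](_ : _ = `|s| * (K * radius t * `|s|)); last by ring.
apply: ler_wpM2l => //; apply: le_trans (ler_normB _ _) _.
apply: le_trans (le_trans tr (ler_wpM2l kr ss)).
by rewrite lerD2r.
Qed.

(* Up to an error [spread], the mass near the mean phase minus the mass near the
   opposite phase. Unlike [radius] it is monotone as long as a trap exists. *)
Definition clustering (t : R) : R := mean t (fun z => step (relcos z.1 t)).

Definition dclustering (t : R) : R :=
  mean t (fun z => - (dstep (relcos z.1 t) * relsin z.1 t *
    (velocity K f z.1 z.2 t - spin t))).

Local Lemma cont_rel t : continuous (fun z : R * R => relcos z.1 t) /\
  continuous (fun z : R * R => relsin z.1 t).
Proof.
split.
- apply: (@continuous_comp_real _ _ (relcos^~ t)); first exact: continuous_relcos.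
  by move=> ?; exact: cvg_fst.
- apply: (@continuous_comp_real _ _ (relsin^~ t)); first exact: continuous_relsin.
  by move=> ?; exact: cvg_fst.
Qed.

Lemma is_derive_clustering (t : R) : 0 < t -> 0 < radius t ->
  is_derive t 1 clustering (dclustering t).
Proof.
move=> t0 r0.
exact: (@is_derive_profile step dstep t t0 r0 is_derive_step continuous_dstep).
Qed.

(** The constants come from the 3-4-5 triangle: [dstep] vanishes for |c| >= 4/5, and elsewhere |s|
    >= 3/5, where the trap drives every oscillator towards phi. *)
Lemma dclustering_ge0 (t : R) : 0 <= t -> 0 < radius t -> trapped (3 / 5) t ->
  0 <= dclustering t.
Proof.
move=> t0 r0 tr; have [c1 c2] := cont_rel t; have cv := continuous_velocity t0.
have c3 : continuous (fun z : R * R => dstep (relcos z.1 t)).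
  by apply: continuous_comp_real => //; exact: continuous_dstep.
have c0 : continuous (fun z : R * R => 0 * relcos z.1 t) by solve_continuous.
have <- : mean t (fun z => 0 * relcos z.1 t) = 0 by rewrite meanZ // mul0r.
apply: le_mean; [solve_continuous..|] => z Dz; rewrite mul0r oppr_ge0 -mulrA.
have [h|h] := leP (4 / 5) `|relcos z.1 t|.
  by rewrite dstep_eq0 // mul0r.
rewrite mulr_ge0_le0 ?dstep_ge0 //; apply: (@trap_pushes (3 / 5)) => //.
have := relcos_sqr z.1 r0; set c := relcos _ _ in h *; set s := relsin _ _.
move=> cs; rewrite -(@ler_pXn2r _ 2) ?nnegrE //.
have : `|c| ^+ 2 < (4 / 5) ^+ 2 by rewrite ltr_pXn2r ?nnegrE.
by rewrite !real_normK ?num_real //; lra.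
Qed.

Lemma clustering_near (t : R) : 0 <= t -> 0 < radius t ->
  `|clustering t - radius t| <= spread t.
Proof.
move=> t0 r0; have [c1 c2] := cont_rel t.
have c3 : continuous (fun z : R * R => step (relcos z.1 t)).
  apply: continuous_comp_real => // c; exact: is_derive_continuous (is_derive_step c).
have E : clustering t - radius t =
    mean t (fun z => step (relcos z.1 t) + -1 * relcos z.1 t).
  rewrite meanD; [|solve_continuous|solve_continuous].
  by rewrite meanZ // mean_relcos // mulN1r.
have sE : - spread t = mean t (fun z => -1 * relsin z.1 t ^+ 2).
  by rewrite meanZ ?mulN1r //; solve_continuous.
have bd (z : R * R) : `|step (relcos z.1 t) - relcos z.1 t| <= relsin z.1 t ^+ 2.
  apply: le_trans (step_near (relcos_le1 z.1 r0)) _.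
  by rewrite -(relcos_sqr z.1 r0) addrC addKr.
rewrite E ler_norml sE; apply/andP; split;
  (apply: le_mean; [solve_continuous..|]); move=> z _;
  by have := bd z; rewrite ler_norml !mulN1r => /andP[].
Qed.

(** With m = (c0 - c)_+, growth of f contributes K R c m^2 and the drift 2 m s (v - spin) is at most
    - K R (c0 + c) m^2. The sum is - K R c0 m^2, which gives the rate K rho c0. The square keeps the
    weight differentiable. *)
Lemma density_decay (T rho c0 s0 : R) : 0 < T -> 0 < rho -> 0 < c0 -> 0 < s0 ->
  c0 ^+ 2 + s0 ^+ 2 = 1 ->
  (forall t, T <= t -> rho <= radius t /\ trapped s0 t) ->
  exists2 C : R, 0 <= C & forall x w t, T <= t ->
    f x w t * pos_sqr (c0 - relcos x t) <= C * expR (- (K * rho * c0 * t)).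
Proof.
move=> T0 rho0 c00 s00 cs1 trap.
have rpos t : T <= t -> 0 < radius t.
  by move=> /trap[+ _]; exact: lt_le_trans.
have tpos (t : R) : T <= t -> 0 < t by exact: lt_le_trans.
set lam := K * rho * c0.
have [Cf Cf0 hCf] := bounded_density T T.
have c01 : c0 <= 1 by nra.
have fT x w : f x w T <= Cf.
  have [|wM] := ltP M `|w|; first by move=> /(support_bounded x (ltW T0)) ->.
  have [k kx] := reduce_mod_2pi x.
  have h : `|fe (x - k%:~R * (pi *+ 2)) w T| <= Cf.
    apply: (hCf (_, w) T); rewrite ?lexx //.
    by split; rewrite /period /= in_itv //= -ler_norml.
  rewrite -(feE x w (ltW T0)).
  rewrite -(@periodic_int _ (fun x => fe x w T) _ k x (fe_periodic w T)).
  exact: le_trans (ler_norm _) h.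
(* The value at time T bounds W later on; 4 bounds the weight because c0 <= 1 and c >= -1. *)
exists (expR (lam * T) * (Cf * 4)); first by rewrite mulr_ge0 ?expR_ge0 // mulr_ge0.
move=> x w t Tt; rewrite expRN ler_pdivlMr ?expR_gt0 // mulrC.
rewrite -(feE x w (ltW (tpos t Tt))).
pose m x t := Num.max 0 (c0 - relcos x t).
have m_ge0 y s : 0 <= m y s by rewrite /m le_max lexx.
pose W (x t : R) := expR (lam * t) * (fe x w t * pos_sqr (c0 - relcos x t)).
pose Wx (x t : R) := expR (lam * t) * (dangle x w t * pos_sqr (c0 - relcos x t) +
  fe x w t * (2 * m x t * relsin x t)).
pose Wt (x t : R) := expR (lam * t) * (lam * (fe x w t * pos_sqr (c0 - relcos x t)) +
  (dtime x w t * pos_sqr (c0 - relcos x t) +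
   fe x w t * (2 * m x t * - (relsin x t * spin t)))).
rewrite -/(W x t).
apply: (@transport_max_principle _ W Wx Wt (fun x t => velocity K f x w t) T
  (expR (lam * T) * (Cf * 4)) _ _ _ _ _ _ x t Tt).
- by move=> s Ts y; rewrite /W relcos_periodic [fe _ _ _]fe_periodic.
- rewrite /W /Wx => y s Ts.
  have H1 := is_derive_relcos_angle y s.
  have H2 : is_derive y 1 (fun y => c0 - relcos y s) (relsin y s).
    by apply: (is_derive_eq (is_deriveB (is_derive_cst c0 y 1) H1));
      rewrite sub0r opprK.
  have H3 := @is_derive1_comp _ pos_sqr (fun y => c0 - relcos y s) y _ _
    (is_derive_pos_sqr _) H2.
  have H4 : is_derive y 1 (fun y => fe y w s) (dangle y w s).
    have -> : (fun y => fe y w s) = (fun y => f y w s).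
      by apply/funext => u; rewrite feE // ltW // tpos.
    exact: is_derive_angle (tpos _ Ts).
  have H5 := is_deriveM H4 H3.
  have H6 := @is_derive_cst _ _ _ (expR (lam * s)) y 1.
  apply: (is_derive_eq (is_deriveM H6 H5)); rewrite /GRing.scale /= /m; ring.
- rewrite /W /Wt => y s Ts.
  have H1 := is_derive_relcos_time y (tpos _ Ts) (rpos _ Ts).
  have H2 : is_derive s 1 (fun s => c0 - relcos y s) (- (relsin y s * spin s)).
    by apply: (is_derive_eq (is_deriveB (is_derive_cst c0 s 1) H1));
      rewrite sub0r.
  have H3 := @is_derive1_comp _ pos_sqr (fun s => c0 - relcos y s) s _ _
    (is_derive_pos_sqr _) H2.
  have H4 := is_derive_fe y w (tpos _ Ts).
  have H5 : is_derive s 1 (fun s => fe y w s * pos_sqr (c0 - relcos y s)) _ :=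
    is_deriveM H4 H3.
  have H7 : is_derive s 1 (fun s : R => lam * s) lam.
    by apply: is_derive_eq; rewrite /GRing.scale /= ?mulr1 ?mulr0 ?addr0 ?add0r.
  have H6 := @is_derive1_comp _ expR (fun s => lam * s) s _ _
    (is_derive_expR _) H7.
  apply: (is_derive_eq (is_deriveM H6 H5)); rewrite /GRing.scale /= /m; ring.
- rewrite /W => T'; apply: continuous_in_subspaceT => -[y s].
  rewrite inE => -[_ /=]; rewrite in_itv /= => /andP[Ts _].
  have cR : {for (y, s), continuous (fun z : R * R => relcos z.1 z.2)}.
    apply: cvgM; last first.
      apply: cvgV; first by rewrite gt_eqF // rpos.
      apply: (@continuous_comp _ _ _ snd radius); first exact: cvg_snd.
      exact: continuous_radius.
    have k1 : continuous (fun z : R * R => mean_cos z.2).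
      apply: (@continuous_comp_real _ _ mean_cos snd); first exact: continuous_mean_cos.
      by move=> ?; exact: cvg_snd.
    have k2 : continuous (fun z : R * R => mean_sin z.2).
      apply: (@continuous_comp_real _ _ mean_sin snd); first exact: continuous_mean_sin.
      by move=> ?; exact: cvg_snd.
    have : continuous (fun z : R * R => mean_cos z.2 * cos z.1 + mean_sin z.2 * sin z.1).
      by solve_continuous.
    by apply.
  apply: cvgM.
    have : continuous (fun z : R * R => expR (lam * z.2)).
      by apply: continuous_comp_real; [exact: continuous_expR | solve_continuous].
    by apply.
  apply: cvgM.
    have : continuous (fun z : R * R => fe z.1 w z.2).
      by apply: cont_fe_comp; solve_continuous.
    by apply.
  apply: (@continuous_comp _ _ _ (fun z : R * R => c0 - relcos z.1 z.2) pos_sqr).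
    by apply: cvgB; [exact: cvg_cst | exact: cR].
  exact: is_derive_continuous (is_derive_pos_sqr _).
- rewrite /Wx /Wt => y s Ts; have s0' := tpos _ Ts; have r0 := rpos _ Ts.
  have [rr tr] := trap _ Ts.
  (* The trap controls only frequencies with |w| <= M; beyond them f and its derivatives are
     zero. *)
  have [wM|wM] := ltP M `|w|.
    have z1 : fe y w s = 0 by rewrite feE ?(ltW s0') // support_bounded // ltW.
    have z2 : dangle y w s = 0.
      rewrite /dangle derive1E (_ : (fun y => f y w s) = cst 0) ?derive_cst //.
      by apply/funext => u; rewrite support_bounded // ltW.
    have z3 : dtime y w s = 0.
      have := is_derive_fe y w s0'.
      rewrite (_ : fe y w = cst 0); last first.
        by apply/funext => u; rewrite /fe support_bounded // le_max lexx orbT.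
      by move=> H; rewrite -(@derive_val _ _ _ _ _ _ _ H) derive_cst.
    by rewrite z1 z2 z3 !(mul0r, mulr0, addr0).
  rewrite dtime_transport // -(feE y w (ltW s0')) /pos_sqr -/(m y s).
  have -> : mean_cos s * cos y + mean_sin s * sin y = radius s * relcos y s.
    by rewrite /relcos; field; rewrite gt_eqF.
  set E := expR _; set F := fe y w s; set a := relcos y s; set b := relsin y s.
  set mm := m y s; set V := velocity _ _ _ _ _; set D := dangle _ _ _.
  rewrite [X in X <= _](_ : _ = E * F * mm * ((lam + K * radius s * a) * mm +
    2 * (b * (V - spin s)))); last by ring.
  have [am|am] := leP (c0 - a) 0.
    have -> : mm = 0 by rewrite /mm /m; apply/max_idPl.
    by rewrite mulr0 mul0r.
  have mmE : mm = c0 - a by rewrite /mm /m; apply/max_idPr/ltW.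
  apply: mulr_ge0_le0.
    by rewrite !mulr_ge0 ?expR_ge0 ?fe_ge0 ?m_ge0.
  have kr : 0 <= K * radius s by rewrite mulr_ge0 // ltW.
  have ab : a ^+ 2 + b ^+ 2 = 1 by exact: relcos_sqr.
  have b2 : `|b| ^+ 2 = b ^+ 2 by rewrite real_normK ?num_real.
  have bV : b * (V - spin s) <= K * radius s * (`|b| * s0 - b ^+ 2).
    have -> : b * (V - spin s) = b * (w - spin s) - K * radius s * b ^+ 2.
      by rewrite /V velocity_rel ?(ltW s0') // -/b; ring.
    rewrite [X in _ <= X]mulrBr lerD2r; apply: le_trans (ler_norm _) _; rewrite normrM.
    rewrite [X in _ <= X](_ : _ = `|b| * (K * radius s * s0)); last by ring.
    apply: ler_wpM2l => //; apply: le_trans (ler_normB _ _) _.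
    by apply: le_trans tr; rewrite lerD2r.
  (* AM-GM makes the drift towards the mean phase absorb the growth of [f]. *)
  have amgm : 2 * (`|b| * s0 - b ^+ 2) <= - ((c0 - a) * (c0 + a)).
    have := sqr_ge0 (`|b| - s0); rewrite -b2 in ab *; nra.
  have lamr : lam <= K * radius s * c0.
    by rewrite /lam ler_wpM2r ?(ltW c00) // ler_wpM2l // ltW.
  rewrite mmE; have := ler_wpM2l kr amgm; have := ler_wpM2r (ltW am) lamr.
  by lra.
- move=> y; rewrite ler_wpM2l ?expR_ge0 // feE ?(ltW T0) //.
  apply: ler_pM => //.
  + by rewrite -(feE y w (ltW T0)); exact: fe_ge0.
  + by rewrite /pos_sqr sqr_ge0.
  have := relcos_le1 y (rpos _ (lexx T)); rewrite ler_norml => /andP[l u].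
  rewrite /pos_sqr (_ : 4 = 2 ^+ 2 :> R); last by ring.
  by rewrite ler_pXn2r ?nnegrE // ?ge_max ?le_max ?lexx //; lra.
Qed.

(** * Dynamics of the order parameter *)

Section Dynamics.
Variable rho : R.
Hypotheses (rho0 : 0 < rho) (rho4 : rho <= 1 / 4)
  (strong : 400 * M <= K * rho ^+ 3).

Let m := M / K.

Let m0 : 0 < m. Proof. exact: divr_gt0. Qed.

Let mE : M = K * m. Proof. by rewrite /m; field; rewrite gt_eqF. Qed.

Let m_le : 400 * m <= rho ^+ 3.
Proof. by rewrite /m mulrA ler_pdivrMr // [X in _ <= X]mulrC. Qed.

(* Below [thin] the forcing by the natural frequencies may beat the coupling;
   up to [wide] the mean phase is slow enough for its 3/5-arc to be a trap. *)
Let thin := (2 * m / rho) ^+ 2.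
Let wide := rho ^+ 2 / 64.

Let q t := Num.sqrt (spread t).

Local Lemma qE t : q t ^+ 2 = spread t.
Proof. by rewrite sqr_sqrtr // spread_ge0. Qed.

Local Lemma q_ge0 t : 0 <= q t. Proof. exact: sqrtr_ge0. Qed.

(** The value of [thin] is chosen for this: the forcing, at most M q, then takes away at most half
    of the coupling term K R q^2. *)
Local Lemma forcing_small (t : R) : 0 <= t -> rho <= radius t -> thin <= spread t ->
  M <= K * radius t * q t / 2.
Proof.
move=> t0 rr th; have r0 := lt_le_trans rho0 rr.
have qthin : 2 * m / rho <= q t.
  rewrite -(@ler_pXn2r _ 2) ?nnegrE ?q_ge0 //; first by rewrite qE.
  by apply/ltW/divr_gt0 => //; exact: mulr_gt0.
have : 2 * m <= radius t * q t.
  have := qthin; rewrite ler_pdivrMr // => /le_trans; apply.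
  by rewrite mulrC ler_wpM2r // q_ge0.
by rewrite mE -!mulrA ler_pM2l // => h; lra.
Qed.

Lemma dradius_ge (t : R) : 0 <= t -> rho <= radius t -> thin <= spread t ->
  K * radius t * spread t / 2 <= dradius t.
Proof.
move=> t0 rr th; have r0 := lt_le_trans rho0 rr.
have := forcing_le t0; rewrite ler_norml => /andP[_].
have := ler_wpM2r (q_ge0 t) (forcing_small t0 rr th).
rewrite -/(q t) /dradius -qE; set N := mean _ _; lra.
Qed.

(** Here |spin| <= (3/2) K q, so S' <= 2 (1/2 + 1 + 3/2) K q^2 = 6 K q^2, while R' >= K rho q^2 / 2;
    the quotient is rho / 12. *)
Lemma dradius_dspread (t : R) : 0 <= t -> rho <= radius t -> thin <= spread t ->
  rho / 12 * dspread t <= dradius t.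
Proof.
move=> t0 rr th; have r0 := lt_le_trans rho0 rr.
have r1 := radius_le1 t0 r0.
have fs := forcing_small t0 rr th.
have := dradius_ge t0 rr th.
have := dspread_le t0 r0; rewrite ler_norml => /andP[_].
have := radius_spin_le t0 r0 (mean_sin_cos_le_spread t0 r0).
rewrite -/(q t) -qE //; set Q := q t in fs *; set r := radius t in rr r0 r1 fs *.
have Q0 : 0 <= Q := q_ge0 t.
move=> sp.
have {}sp : `|spin t| <= K * Q * (3 / 2).
  have : r * `|spin t| <= r * (K * Q * (3 / 2)) by lra.
  by rewrite ler_pM2l.
have KQ : 0 <= K * Q by rewrite mulr_ge0 // ltW.
have e1 := ler_wpM2r Q0 sp.
have e2 : M * Q <= K * Q * Q / 2.
  apply: le_trans (ler_wpM2r Q0 fs) _.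
  have := ler_wpM2r Q0 (ler_wpM2l KQ r1); lra.
have e3 : K * r * Q ^+ 2 <= K * Q * Q.
  by have := ler_wpM2r Q0 (ler_wpM2l KQ r1); lra.
move=> ds; have {}ds : dspread t <= 6 * (K * Q * Q) by lra.
move=> dr; apply: le_trans dr.
have rho12 : 0 <= rho / 12 by apply/ltW/divr_gt0.
have := ler_wpM2l rho12 ds.
have KQQ : 0 <= K * Q * Q by rewrite mulr_ge0.
by have := ler_wpM2r KQQ rr; lra.
Qed.

Local Lemma m_small : m * (1 + 1 / rho) <= rho / 100.
Proof.
rewrite mulrDr mulr1 mul1r.
have : m / rho <= rho ^+ 2 / 400.
  rewrite ler_pdivrMr //; have := m_le; rewrite exprSr; lra.
have r2 : rho ^+ 2 <= rho / 4.
  by rewrite expr2; have := ler_wpM2l (ltW rho0) rho4; lra.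
have r3 : rho ^+ 3 <= rho / 4.
  rewrite exprSr; have := ler_wpM2r (ltW rho0) r2.
  by have := ler_wpM2l (ltW rho0) rho4; have := rho0; lra.
have := m_le; have := rho0; lra.
Qed.

(** As [wide] is (rho / 8)^2, M + |spin| is at most K rho (1/100 + 1/8), well below (3/5) K R. *)
Lemma trapped_below_wide (t : R) : 0 <= t -> rho <= radius t ->
  spread t <= wide -> trapped (3 / 5) t.
Proof.
move=> t0 rr sw; have r0 := lt_le_trans rho0 rr.
have qw : q t <= rho / 8.
  rewrite -(@ler_pXn2r _ 2) ?nnegrE ?q_ge0 //; last by rewrite divr_ge0 // ltW.
  by rewrite qE // (le_trans sw) // /wide; lra.
have := radius_spin_le t0 r0 (mean_sin_cos_le_spread t0 r0).
rewrite -/(q t) /trapped; set r := radius t in rr r0 *; set Q := q t in qw *.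
have Q0 : 0 <= Q := q_ge0 t.
move=> sp; have {}sp : `|spin t| <= M / r + K * Q.
  rewrite -(ler_pM2l r0) mulrDr (_ : r * (M / r) = M); last by field; rewrite gt_eqF.
  by apply: le_trans sp _; lra.
have Mr : M / r <= M / rho.
  by rewrite ler_pM2l // lef_pV2.
have ms := ler_wpM2l (ltW K0) m_small.
have Mm : K * (m * (1 + 1 / rho)) = M + M / rho.
  by rewrite mE; field; rewrite gt_eqF.
have := ler_wpM2l (ltW K0) qw; have := ler_wpM2l (ltW K0) rr.
have := mulr_gt0 K0 rho0; lra.
Qed.

(** Otherwise R' >= c > 0 as long as R is at least its starting value; the barrier makes this last
    forever, and R would gain 2 within time 2 / c. *)
Lemma reach_thin (t0 : R) : 0 < t0 -> rho <= radius t0 ->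
  exists2 t1, t0 <= t1 & radius t0 <= radius t1 /\ spread t1 <= thin.
Proof.
move=> t00 rr; apply: contrapT => no.
have {}no (t : R) : t0 <= t -> radius t0 <= radius t -> thin < spread t.
  move=> tt rt; rewrite ltNge; apply/negP => st; apply: no.
  by exists t.
have r0 := lt_le_trans rho0 rr.
have thin0 : 0 < thin.
  by rewrite exprn_gt0 // divr_gt0 // mulr_gt0.
pose c := K * rho * thin / 2.
have c0 : 0 < c.
  by apply: divr_gt0 => //; apply: mulr_gt0 => //; exact: mulr_gt0.
have dr (t : R) : t0 <= t -> radius t0 <= radius t -> c <= dradius t.
  move=> tt rt; have st := no t tt rt.
  have tpos : 0 <= t by lra.
  have rrt : rho <= radius t by lra.
  apply: le_trans (dradius_ge tpos rrt (ltW st)).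
  rewrite /c ler_pM2r // -!mulrA ler_pM2l //.
  by apply: ler_pM => //; rewrite ltW.
have up (t : R) : t0 <= t -> radius t0 <= radius t.
  move=> tt; apply: (@barrier _ radius t0 t (radius t0)) => //.
    exact: continuous_radius.
  move=> s sP e; exists (dradius s); first by apply: lt_le_trans c0 (dr _ _ _); lra.
  by apply: is_derive_dradius => //; lra.
have dd (t : R) : t0 <= t -> is_derive t 1 radius (dradius t).
  move=> tt; have := up t tt; move=> rt; apply: is_derive_dradius; lra.
pose T := t0 + 2 / c.
have T0 : t0 <= T by rewrite lerDl divr_ge0 // ltW.
have gr := @growth_ge _ radius dradius t0 T c T0.
have : c * (T - t0) <= radius T - radius t0.
  apply: gr => t /andP[tt _]; first exact: dd.
  exact: dr (up _ _).
rewrite /T addrAC subrr add0r (_ : c * (2 / c) = 2); last by field; rewrite gt_eqF.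
have rT := up T T0; have r1 : radius T <= 1 by apply: radius_le1; lra.
lra.
Qed.

Let wide0 : 0 < wide. Proof. by apply: divr_gt0 => //; exact: exprn_gt0. Qed.

(** The budget of one excursion: at most 2 [thin] is lost before it, rho / 12 times (wide - thin) is
    gained during it, and at least rho wide / 24 remains. *)
Local Lemma thin_wide : thin * (2 + rho / 12) <= rho * wide / 24.
Proof.
have e : rho ^+ 5 = rho ^+ 2 * rho ^+ 3 by ring.
have mm : (400 * m) ^+ 2 <= rho ^+ 3 * rho ^+ 3.
  have m400 : 0 <= 400 * m := mulr_ge0 (ler0n _ 400) (ltW m0).
  by rewrite expr2; exact (ler_pM m400 m400 m_le m_le).
have thinE : thin * rho ^+ 2 = 4 * m ^+ 2.
  by rewrite /thin; field; rewrite gt_eqF.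
have r2 : 0 < rho ^+ 2 by rewrite exprn_gt0.
rewrite -(ler_pM2r r2) mulrAC thinE /wide.
have r3 : rho ^+ 3 <= rho ^+ 2 / 4.
  by rewrite exprSr; have := ler_wpM2l (ltW r2) rho4; lra.
have r5 : 0 <= rho ^+ 5 by rewrite exprn_ge0 // ltW.
have r6 : rho ^+ 3 * rho ^+ 3 <= rho ^+ 5 / 4.
  have := ler_wpM2r (ltW (exprn_gt0 3 rho0)) r3; rewrite e; lra.
have m2 : 0 <= m ^+ 2 by rewrite sqr_ge0.
have m2r : m ^+ 2 * rho <= m ^+ 2 / 4.
  by have := ler_wpM2l m2 rho4; lra.
rewrite (_ : rho * (rho ^+ 2 / 64) / 24 * rho ^+ 2 = rho ^+ 5 / 64 / 24); last by field.
lra.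
Qed.

Local Lemma rho1 : rho < 2 * rho /\ 2 * wide < rho.
Proof.
have := rho0; rewrite /wide; have := ler_wpM2l (ltW rho0) rho4.
rewrite expr2; lra.
Qed.

(** Since [clustering] does not decrease on [a, b] and is within [spread] of [radius], the loss is
    read off at the two ends, however long the interval. *)
Local Lemma radius_loss (a b : R) : 0 < a -> a <= b ->
  (forall u, a <= u <= b -> rho <= radius u /\ spread u <= wide) ->
  radius a - spread a - spread b <= radius b.
Proof.
move=> a0 ab good.
have pos (u : R) : a <= u <= b -> 0 < radius u.
  by move=> /good[+ _]; exact: lt_le_trans.
have b0 : 0 < b by lra.
have gr := @growth_ge _ clustering dclustering a b 0 ab.
have : 0 * (b - a) <= clustering b - clustering a.
  apply: gr => u ub; have [u1 u2] := good u ub.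
    by apply: is_derive_clustering; [lra | exact: pos].
  by apply: dclustering_ge0; [lra | exact: pos | apply: trapped_below_wide => //; lra].
have := clustering_near (ltW a0) (pos a (ltac:(lra))).
have := clustering_near (ltW b0) (pos b (ltac:(lra))).
rewrite !ler_norml mul0r; lra.
Qed.

(* Leaving the wide regime from a thin time raises [radius] by a fixed amount,
   so it cannot happen after a thin time at which [radius] is nearly maximal. *)
Lemma eventually_wide (t0 : R) : 0 < t0 -> 2 * rho <= radius t0 ->
  exists2 T, t0 <= T & forall t, T <= t -> rho <= radius t /\ spread t <= wide.
Proof.
move=> t00 rr0; have [rr2 w2] := rho1.
pose E := [set x | exists t, [/\ t0 <= t, x = radius t, spread t <= thin
  & 2 * rho <= radius t]].
have reach (t : R) : t0 <= t -> 2 * rho <= radius t ->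
    exists2 x, E x & radius t <= x.
  move=> tt rt; have [||t1 tt1 [r1 s1]] := @reach_thin t; [lra|lra|].
  by exists (radius t1) => //; exists t1; split => //; lra.
have supE : has_sup E.
  have [x Ex _] := reach t0 (lexx _) rr0; split; first by exists x.
  exists 1 => y [t [tt -> _ rt]]; apply: radius_le1; lra.
have gap : 0 < rho * wide / 24 by apply: divr_gt0 => //; exact: mulr_gt0.
have [_ [T [tT -> sT rT]] supT] := sup_adherent gap supE.
have T0 : 0 < T by lra.
have thin_lt : thin < wide.
  have th0 : 0 < thin by apply: exprn_gt0; apply: divr_gt0 => //; exact: mulr_gt0.
  have := thin_wide; have := mulr_gt0 th0 rho0; have := wide0.
  have := ler_wpM2r (ltW wide0) rho4; lra.
exists T => // t Tt.
suff : Num.max (spread t - wide) (rho - radius t) < 0.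
  by rewrite gt_max => /andP[? ?]; split; lra.
rewrite ltNge; apply/negP => bad.
(* The time s is the first one at which either bound fails. Continuity of [spread] at u requires
   radius u > 0, which is inherited from the bound rho at earlier times. *)
have [|u uP|s sP [sE before]] := @first_above _
    (fun t => Num.max (spread t - wide) (rho - radius t)) T t 0 Tt _ bad.
- by rewrite gt_max; apply/andP; split; lra.
- move=> before.
  have ru : 0 < radius u.
    have [->|uT] := eqVneq u T; first by have := rho0; lra.
    have {}uT : T < u by rewrite lt_neqAle eq_sym uT; lra.
    rewrite (lt_le_trans rho0) // leNgt; apply/negP => h.
    have e0 : 0 < rho - radius u by lra.
    have [d d0 hd] := continuous_at_dist (@continuous_radius u) e0.
    pose v := Num.max T (u - d / 2).
    have v1 : T <= v by rewrite /v le_max lexx.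
    have v2 : u - d / 2 <= v by rewrite /v le_max lexx orbT.
    have v3 : v < u by rewrite /v gt_max; lra.
    have := before v; rewrite v1 v3 gt_max => /(_ isT) /andP[_].
    by have := hd v; rewrite !ltr_norml; lra.
  have u0 : 0 < u by lra.
  apply: (@continuous_max _ _ (fun t => spread t - wide) (fun t => rho - radius t)).
    apply: cvgB; last exact: cvg_cst.
    exact: is_derive_continuous (is_derive_spread ru u0).
  by apply: cvgB; [exact: cvg_cst | exact: continuous_radius].
have good (u : R) : T <= u <= s -> rho <= radius u /\ spread u <= wide.
  move=> uP; suff : Num.max (spread u - wide) (rho - radius u) <= 0.
    by rewrite ge_max => /andP[? ?]; split; lra.
  have [->|us] := eqVneq u s; first by rewrite sE.
  by apply/ltW/before; rewrite lt_neqAle us.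
have Ts : T <= s by lra.
have rs := radius_loss T0 Ts good.
have [gs1 gs2] := good s (ltac:(lra)).
(* By [radius_loss], R has lost at most thin + wide < rho since T, so radius s > rho and the exit
   happens through [spread]. *)
have ss : spread s = wide.
  apply/eqP; rewrite eq_le gs2 leNgt; apply/negP => h.
  have : Num.max (spread s - wide) (rho - radius s) < 0.
    by rewrite gt_max; apply/andP; split; lra.
  by rewrite sE ltxx.
(* After the last thin time v, R - (rho / 12) S is nondecreasing up to s; before v, [radius_loss]
   applies with [thin] at both ends. *)
have [||v vP [vE after]] := @last_below _ spread T s thin Ts sT.
- by rewrite ss.
- move=> u uP _; have [u1 _] := good u uP.
  apply: is_derive_continuous (is_derive_spread _ _); last lra.
  exact: lt_le_trans u1.
have Tv : T <= v by lra.
have rv : radius T - spread T - spread v <= radius v.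
  apply: radius_loss => // u uP; apply: good; lra.
pose G t := radius t - rho / 12 * spread t.
pose dG t := dradius t - rho / 12 * dspread t.
have vs : v <= s by lra.
have gG := @growth_ge _ G dG v s 0 vs.
have : 0 * (s - v) <= G s - G v.
  apply: gG => u uP; have [u1 _] := good u (ltac:(lra)).
    have ru := lt_le_trans rho0 u1; have u0 : 0 < u by lra.
    have H1 := is_derive_dradius (ltW u0) ru u0; have H2 := is_derive_spread ru u0.
    by apply: is_derive_eq; rewrite /dG /GRing.scale /= ?mulr0 ?addr0.
  rewrite /dG subr_ge0; apply: dradius_dspread => //; first lra.
  have [->|uv] := eqVneq u v; first by rewrite vE.
  by apply/ltW/after; rewrite lt_neqAle eq_sym uv; lra.
rewrite mul0r /G vE ss => gain.
have := thin_wide => tw.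
have rTs : radius T + rho * wide / 24 <= radius s.
  have : 0 <= rho * thin by apply: mulr_ge0; [exact: ltW | exact: sqr_ge0].
  lra.
(* The next thin time has a radius at least that of s, hence above the supremum of E. *)
have [||x Ex xs] := reach s; [lra|lra|].
by have := sup_upper_bound supE Ex; lra.
Qed.

Lemma scaled_exp_small (A lam k t : R) : 0 <= A -> 0 < lam -> 0 < k ->
  A / (k * lam) <= t -> A * expR (- (lam * t)) <= k.
Proof.
move=> A0 lam0 k0; rewrite ler_pdivrMr ?mulr_gt0 // => h.
rewrite expRN ler_pdivrMr ?expR_gt0 //; apply: (@le_trans _ _ (k * (1 + lam * t))).
  by rewrite mulrDr mulr1; lra.
by rewrite ler_pM2l // expR_ge1Dx.
Qed.

Lemma R_inftyE : R_infty M K = 1 - (Num.sqrt (m ^+ 2 + 4 * m) - m).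
Proof.
rewrite /R_infty -/m -expr_div_n -/m; ring.
Qed.

(** The number m = M / K lies between: thin is 4 m^2 / rho^2 with 4 m <= rho^2, and sqrt (m^2 + 4 m)
    >= 2 m since m <= 1. *)
Local Lemma thin_gap : thin <= 1 - R_infty M K.
Proof.
have r2 : 0 < rho ^+ 2 by rewrite exprn_gt0.
have mr : 4 * m <= rho ^+ 2.
  have := m_le; rewrite exprSr; have := ler_wpM2l (ltW r2) rho4; lra.
have thm : thin <= m.
  rewrite /thin expr_div_n ler_pdivrMr //.
  by have := ler_wpM2l (ltW m0) mr; lra.
rewrite R_inftyE opprB addrC subrK; apply: le_trans thm _.
rewrite lerBrDr -[X in X <= _]gtr0_norm ?addr_gt0 // -sqrtr_sqr.
rewrite ler_wsqrtr //.
have m1 : m <= 1 by have := ler_wpM2l (ltW rho0) rho4; have := rho4; have := rho0;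
  rewrite expr2 in mr; lra.
have := ler_wpM2l (ltW m0) m1; have := m0; lra.
Qed.

(** * Convergence once the last excursion is over *)

Section AfterTrapping.
Variable T : R.
Hypotheses (T0 : 0 < T)
  (trappedT : forall t, T <= t -> rho <= radius t /\ spread t <= wide).

Local Lemma posT (t : R) : T <= t -> 0 <= t.
Proof. by move=> /(lt_le_trans T0)/ltW. Qed.

(** For c >= 0 one has c >= c^2 = 1 - s^2; the mass where this fails decays exponentially, so
    averaging gives R >= 1 - S up to that error. *)
Lemma spread_ge_exp : exists A lam : R, [/\ 0 <= A, 0 < lam &
  forall t, T <= t -> 1 - radius t - A * expR (- (lam * t)) <= spread t].
Proof.
have p45 : 0 < 4 / 5 :> R by lra.
have p35 : 0 < 3 / 5 :> R by lra.
have [|t Tt|C C0 decay] := @density_decay T rho (4 / 5) (3 / 5) T0 rho0 p45 p35.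
- by field.
- have [r1 s1] := trappedT Tt; split => //.
  by apply: trapped_below_wide => //; exact: posT.
pose V := fine (leb2 band).
have V0 : 0 <= V by apply: fine_ge0.
exists (25 / 8 * (V * C)), (K * rho * (4 / 5)); split.
- by rewrite mulr_ge0 // mulr_ge0.
- by rewrite mulr_gt0 // mulr_gt0.
move=> t Tt; have t0 := posT Tt; have [r1 _] := trappedT Tt.
have r0 := lt_le_trans rho0 r1; have [c1 c2] := cont_rel t.
set e := expR _.
have ceta : continuous (fun z : R * R => pos_sqr (4 / 5 - relcos z.1 t)).
  apply: (@continuous_comp_real _ _ pos_sqr); last by solve_continuous.
  by move=> u; exact: is_derive_continuous (is_derive_pos_sqr u).
have out : mean t (fun z => pos_sqr (4 / 5 - relcos z.1 t)) <= V * C * e.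
  rewrite (_ : V * C * e = \int[leb2]_(z in band) (cst (C * e) z)); last first.
    by rewrite Rintegral_cst; [rewrite /V; ring | exact: measurable_rectangle].
  apply: le_Rintegral_rectangle.
  - exact: cont_mul_fe.
  - by move=> z; exact: cvg_cst.
  move=> z _; rewrite -/(fe _ _ _) feE // mulrC; exact: decay.
(* For c < 0 the deficit c^2 - c is at most 2 and (4/5 - c)^2 is at least 16/25, whence the factor
   25/8. *)
have : mean t (fun z => 1 + (- 1 * relsin z.1 t ^+ 2 +
    - (25 / 8) * pos_sqr (4 / 5 - relcos z.1 t))) <= mean t (fun z => relcos z.1 t).
  apply: le_mean; [solve_continuous..|] => z _.
  have := relcos_sqr z.1 r0; have := relcos_le1 z.1 r0; rewrite ler_norml.
  set c := relcos _ _; set s := relsin _ _; rewrite /pos_sqr => /andP[l u] cs.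
  have -> : s ^+ 2 = 1 - c ^+ 2 by lra.
  by case: (leP 0 (4 / 5 - c)) => h; nra.
rewrite meanD; [|solve_continuous|solve_continuous].
rewrite meanD; [|solve_continuous|solve_continuous].
rewrite mean1 // meanZ; last by solve_continuous.
rewrite meanZ // mean_relcos // -/(spread t); lra.
Qed.

(** The margin kappa absorbs the exponential error: below the level R_infty - kappa the spread is at
    least [thin], so R' >= c. Hence R reaches the level, and the same inequality forbids crossing it
    downwards. *)
Lemma eventually_near_R_infty (kappa : R) : 0 < kappa ->
  exists2 T', T <= T' & forall t, T' <= t -> R_infty M K - kappa <= radius t.
Proof.
move=> k0; have [A [lam [A0 lam0 low]]] := spread_ge_exp.
pose T1 := Num.max T (A / (kappa * lam)).
have TT1 : T <= T1 by rewrite /T1 le_max lexx.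
have thick (t : R) : T1 <= t -> radius t <= R_infty M K - kappa ->
    thin <= spread t.
  move=> tt rt; have Tt : T <= t by lra.
  have tA : A / (kappa * lam) <= t.
    by apply: le_trans tt; rewrite /T1 le_max lexx orbT.
  have := scaled_exp_small A0 lam0 k0 tA; have := low t Tt; have := thin_gap; lra.
have thin0 : 0 < thin by apply: exprn_gt0; apply: divr_gt0 => //; exact: mulr_gt0.
pose c := K * rho * thin / 2.
have c0 : 0 < c.
  by apply: divr_gt0 => //; apply: mulr_gt0 => //; exact: mulr_gt0.
have grow (t : R) : T1 <= t -> radius t <= R_infty M K - kappa -> c <= dradius t.
  move=> tt rt; have Tt : T <= t by lra.
  have [r1 _] := trappedT Tt; have st := thick t tt rt.
  apply: le_trans (dradius_ge (posT Tt) r1 st).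
  rewrite /c ler_pM2r // -!mulrA ler_pM2l //.
  by apply: ler_pM => //; exact: ltW.
have dd (t : R) : T <= t -> is_derive t 1 radius (dradius t).
  move=> Tt; have [r1 _] := trappedT Tt; have t0 := lt_le_trans T0 Tt.
  exact: is_derive_dradius (ltW t0) (lt_le_trans rho0 r1) t0.
have [T2 TT2 rT2] : exists2 T2, T1 <= T2 & R_infty M K - kappa <= radius T2.
  apply: contrapT => no.
  have {}no (t : R) : T1 <= t -> radius t < R_infty M K - kappa.
    move=> tt; rewrite ltNge; apply/negP => rt; apply: no; by exists t.
  pose S := T1 + 2 / c.
  have T1S : T1 <= S by rewrite lerDl divr_ge0 // ltW.
  have gr := @growth_ge _ radius dradius T1 S c T1S.
  have : c * (S - T1) <= radius S - radius T1.
    apply: gr => t /andP[tt _]; first by apply: dd; lra.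
    exact/grow/ltW/no.
  rewrite /S addrAC subrr add0r (_ : c * (2 / c) = 2); last by field; rewrite gt_eqF.
  have [r1 _] := trappedT TT1.
  have TS : T <= S by lra.
  have [rS _] := trappedT TS; have := rho0.
  have := radius_le1 (posT TS) (lt_le_trans rho0 rS); lra.
exists T2; first lra.
move=> t tt; apply: (@barrier _ radius T2 t) => //; first exact: continuous_radius.
move=> s sP e; exists (dradius s); last by apply: dd; lra.
by apply: lt_le_trans c0 (grow _ _ _); [lra|rewrite e].
Qed.

End AfterTrapping.

End Dynamics.

(** The origin of [sin_trap]: |spin| <= M / R + K (1 - R), and the trap condition M + M / R + K (1 -
    R) <= K R s0, solved for s0 at R = R_infty, gives that expression. *)
Lemma trapped_of_radius (t r1 s0 : R) : 0 <= t -> 0 < r1 -> r1 <= radius t ->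
  0 <= s0 -> M / K * (1 + 1 / r1) + 1 - r1 <= r1 * s0 -> trapped s0 t.
Proof.
move=> t0 r10 rr s00 h; have r0 := lt_le_trans r10 rr.
have := radius_spin_le t0 r0 (mean_sin_cos_le_radius t0 r0).
rewrite /trapped; set r := radius t in rr r0 *; set om := `|spin t| => sp.
have {}sp : om <= M / r + K * (1 - r).
  rewrite -(ler_pM2l r0) mulrDr (_ : r * (M / r) = M); last by field; rewrite gt_eqF.
  by apply: le_trans sp _; lra.
have Mr : M / r <= M / r1 by rewrite ler_pM2l // lef_pV2.
have := ler_wpM2l (ltW K0) h.
rewrite (_ : K * (M / K * (1 + 1 / r1) + 1 - r1) = M + M / r1 + K * (1 - r1)); last first.
  by field; rewrite !gt_eqF.
have := ler_wpM2l (ltW K0) rr; have := ler_wpM2r s00 (ler_wpM2l (ltW K0) rr).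
lra.
Qed.

(* The sine of the half width of [L_infty] at [eps = 0]. *)
Definition sin_trap : R := M / K * ((1 + R_infty M K) / R_infty M K ^+ 2) +
  (1 - R_infty M K) / R_infty M K.

Lemma R_infty_bounds : 400 * M <= K -> 9 / 10 <= R_infty M K /\ R_infty M K <= 1.
Proof.
move=> MK; pose n := M / K; have n0 : 0 < n by exact: divr_gt0.
have n400 : 400 * n <= 1 by rewrite /n mulrA ler_pdivrMr // mul1r.
have E : R_infty M K = 1 + n - Num.sqrt (n ^+ 2 + 4 * n).
  by rewrite /R_infty expr_div_n.
have nn : n ^+ 2 <= n / 400.
  by rewrite expr2; have := ler_wpM2l (ltW n0) n400; lra.
have n2 : 0 <= n ^+ 2 by exact: sqr_ge0.
rewrite E; split.
  suff : Num.sqrt (n ^+ 2 + 4 * n) <= n + 1 / 10 by lra.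
  rewrite -[X in _ <= X]gtr0_norm -?sqrtr_sqr; last by lra.
  by rewrite ler_wsqrtr //; lra.
suff : n <= Num.sqrt (n ^+ 2 + 4 * n) by lra.
rewrite -[X in X <= _]gtr0_norm // -sqrtr_sqr ler_wsqrtr //; lra.
Qed.

Lemma sin_trap_bounds : 400 * M <= K ->
  0 <= sin_trap /\ sin_trap <= 1 / 5.
Proof.
move=> MK; have [Ri1 Ri2] := R_infty_bounds MK.
rewrite /sin_trap; set n := M / K; set y := R_infty M K in Ri1 Ri2 *.
have n0 : 0 < n by exact: divr_gt0.
have n400 : 400 * n <= 1 by rewrite /n mulrA ler_pdivrMr // mul1r.
have y0 : 0 < y by lra.
have y20 : 0 < y ^+ 2 by exact: exprn_gt0.
have y2 : 81 / 100 <= y ^+ 2.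
  by rewrite expr2; have := ler_pM (ltac:(lra) : 0 <= 9 / 10 :> R)
    (ltac:(lra) : 0 <= 9 / 10 :> R) Ri1 Ri1; lra.
have e1 : 0 <= (1 + y) / y ^+ 2 by apply: divr_ge0; lra.
have e2 : (1 + y) / y ^+ 2 <= 3 by rewrite ler_pdivrMr //; lra.
have e3 : 0 <= (1 - y) / y by apply: divr_ge0; lra.
have e4 : (1 - y) / y <= 1 / 9 by rewrite ler_pdivrMr //; lra.
split; first by rewrite addr_ge0 // mulr_ge0 // ltW.
have := ler_wpM2l (ltW n0) e2; lra.
Qed.

Lemma eventually_trapped (T s0 : R) : 400 * M <= K -> 0 < T ->
  (forall kappa : R, 0 < kappa -> exists2 T', T <= T' &
    forall t, T' <= t -> R_infty M K - kappa <= radius t) ->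
  sin_trap < s0 -> s0 <= 1 ->
  exists2 T', T <= T' & forall t, T' <= t -> 1 / 5 <= radius t /\ trapped s0 t.
Proof.
move=> MK T0 ev ss s01; have [Ri1 Ri2] := R_infty_bounds MK.
have [st0 _] := sin_trap_bounds MK.
move: ev ss st0; rewrite /sin_trap.
set n := M / K; set y := R_infty M K in Ri1 Ri2 *.
have n0 : 0 < n by exact: divr_gt0.
have n400 : 400 * n <= 1 by rewrite /n mulrA ler_pdivrMr // mul1r.
have y0 : 0 < y by lra.
set ts := n * _ + _ => ev ss st0.
have tsE : n * (1 + 1 / y) + 1 - y = y * ts by rewrite /ts; field; rewrite gt_eqF.
(* Lowering R_infty by k raises the left-hand side by little more than k, whereas the excess 10 k of
   s0 over the critical sine is worth about 9 k on the right; the division by 10 leaves room for the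
   remaining errors. *)
pose k := (s0 - ts) / 10.
have k0 : 0 < k by rewrite divr_gt0 // subr_gt0.
have k1 : k <= 1 / 10 by rewrite /k; lra.
have [T' TT' hT'] := ev k k0; exists T' => // t tt.
have rt := hT' t tt; split; first by lra.
have yk0 : 0 < y - k by lra.
apply: (@trapped_of_radius t (y - k)) => //; [lra|lra|].
have yk : (y - k)^-1 - y^-1 <= 2 * k.
  have -> : (y - k)^-1 - y^-1 = k / ((y - k) * y).
    by field; rewrite !gt_eqF.
  rewrite ler_pdivrMr ?mulr_gt0 //.
  have : 1 <= 2 * ((y - k) * y).
    have := ler_pM (ltac:(lra) : 0 <= 8 / 10 :> R) (ltac:(lra) : 0 <= 9 / 10 :> R)
      (ltac:(lra) : 8 / 10 <= y - k) Ri1; lra.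
  by move=> h; have := ler_wpM2l (ltW k0) h; lra.
have nk := ler_wpM2l (ltW n0) yk.
have nk1 : n * k <= k / 400 by have := ler_wpM2r (ltW k0) n400; lra.
have e : n * (1 + 1 / (y - k)) = n * (1 + 1 / y) + n * ((y - k)^-1 - y^-1) by ring.
have -> : s0 = ts + 10 * k by rewrite /k; field.
rewrite -/n e.
have kk : 0 <= k * (1 / 10 - k) by apply: mulr_ge0; lra.
have kts : k * ts <= k by rewrite -[X in _ <= X]mulr1 ler_wpM2l //; lra.
have ky := ler_wpM2l (ltW k0) Ri1.
lra.
Qed.

Lemma asymptotics : 0 < radius 0 -> 400 * M * (4 / radius 0) ^+ 3 <= K ->
  (forall kappa : R, 0 < kappa -> exists T : R,
    forall t, T <= t -> R_infty M K - kappa <= radius t) /\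
  (forall c0 s0 : R, 0 < c0 -> sin_trap < s0 -> c0 ^+ 2 + s0 ^+ 2 = 1 ->
    exists T C lam : R, [/\ 0 < T, 0 <= C, 0 < lam &
      forall x w t, T <= t -> 0 < radius t /\
        f x w t * pos_sqr (c0 - relcos x t) <= C * expR (- (lam * t))]).
Proof.
move=> R0 KR.
have R1 : radius 0 <= 1 by exact: radius_le1.
pose rho := radius 0 / 4.
have rho0 : 0 < rho by rewrite divr_gt0.
have rho4 : rho <= 1 / 4 by rewrite /rho; lra.
have strong : 400 * M <= K * rho ^+ 3.
  have := ler_wpM2r (ltW (exprn_gt0 3 rho0)) KR.
  rewrite (_ : 400 * M * (4 / radius 0) ^+ 3 * rho ^+ 3 = 400 * M) //.
  by rewrite /rho; field; rewrite gt_eqF.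
have MK : 400 * M <= K.
  apply: le_trans strong _; rewrite -[X in _ <= X]mulr1 ler_wpM2l ?(ltW K0) //.
  by rewrite exprn_ile1 ?(ltW rho0) //; lra.
(* The dynamics is available only for t > 0, so the argument starts at a small positive time, where
   R is still at least R_0 / 2 = 2 rho. *)
have [h h0 hh] := continuous_at_dist (@continuous_radius 0) (ltac:(lra) : 0 < radius 0 / 2).
have rtau : 2 * rho <= radius (h / 2).
  by have := hh (h / 2); rewrite !ltr_norml /rho; lra.
have tau0 : 0 < h / 2 by rewrite divr_gt0.
have [T tT hT] := eventually_wide rho0 rho4 strong tau0 rtau.
have T0 : 0 < T by lra.
have ev := eventually_near_R_infty rho0 rho4 strong T0 hT.
split; first by move=> k /ev[T' _ hT']; exists T'.
move=> c0 s0 c00 ss cs.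
have [st0 _] := sin_trap_bounds MK.
have s00 : 0 < s0 by lra.
have s01 : s0 <= 1 by nra.
have [T' TT' hT'] := eventually_trapped MK T0 ev ss s01.
have T'0 : 0 < T' by lra.
have p5 : 0 < 1 / 5 :> R by lra.
have [C C0 hC] := density_decay T'0 p5 c00 s00 cs hT'.
exists T', C, (K * (1 / 5) * c0); split=> //; first by rewrite !mulr_gt0.
move=> x w t tt; split; last exact: hC.
by have [r1 _] := hT' t tt; lra.
Qed.

End Solution.

(** * The arc and the essential supremum *)

Lemma cos_ge_1B {R : realType} (x : R) : 0 <= x -> 1 - x <= cos x.
Proof.
move=> x0; have gr := @growth_ge _ (fun y : R => cos y + y) (fun y => - sin y + 1) 0 x 0 x0.
have : 0 * (x - 0) <= (cos x + x) - (cos 0 + 0 : R).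
  by apply: gr => t _; have := sin_le1 t; lra.
by rewrite mul0r cos0; lra.
Qed.

Lemma sin_le_id {R : realType} (x : R) : 0 <= x -> sin x <= x.
Proof.
move=> x0; have gr := @growth_ge _ (fun y : R => y - sin y) (fun y => 1 - cos y) 0 x 0 x0.
have : 0 * (x - 0) <= (x - sin x) - (0 - sin 0 : R).
  by apply: gr => t _; have := cos_le1 t; lra.
by rewrite mul0r sin0; lra.
Qed.

(* Here [sin alpha = s]; the density decays outside the arc of half width
   [alpha + eps / 4]. *)
Lemma trap_angles {R : realType} (s eps : R) : 0 <= s -> s <= 1 / 5 ->
  0 < eps < 1 ->
  let alpha := acos (Num.sqrt (1 - s ^+ 2)) in
  [/\ 0 < cos (alpha + eps / 4), s < sin (alpha + eps / 4),
      cos (alpha + eps / 2) < cos (alpha + eps / 4),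
      0 <= alpha + eps / 2 & alpha + eps / 2 <= pi].
Proof.
move=> s0 s5 /andP[e0 e1] alpha.
have s2 : s ^+ 2 <= 1 / 25.
  by rewrite expr2; have := ler_pM s0 s0 s5 s5; lra.
have s20 : 0 <= s ^+ 2 := sqr_ge0 s.
pose c := Num.sqrt (1 - s ^+ 2); have aE : alpha = acos c by [].
move: alpha aE => alpha aE.
have c2 : c ^+ 2 = 1 - s ^+ 2 by rewrite /c sqr_sqrtr //; lra.
have c0 : 0 <= c := sqrtr_ge0 _.
have c1 : c <= 1.
  rewrite -(@ler_pXn2r _ 2) ?nnegrE // c2 expr1n; lra.
have c9 : 9 / 10 <= c.
  rewrite -(@ler_pXn2r _ 2) ?nnegrE // ?c2; lra.
have cP : -1 <= c <= 1 by lra.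
have a0 : 0 <= alpha by rewrite aE acos_ge0.
have api : alpha <= pi by rewrite aE acos_lepi.
have ca : cos alpha = c by rewrite aE acosK // in_itv.
have sa : sin alpha = s.
  rewrite aE sin_acos // c2 opprB addrC subrK.
  by rewrite sqrtr_sqr ger0_norm.
have pi2 := @pi_ge2 R.
have e4 : 0 <= eps / 4 by lra.
have cosb : 0 < cos (alpha + eps / 4).
  rewrite cosD ca sa.
  have k1 := cos_ge_1B e4; have k2 := sin_le_id e4.
  have h1 : 9 / 10 * (3 / 4) <= c * cos (eps / 4).
    by apply: ler_pM => //; lra.
  have h2 : s * sin (eps / 4) <= 1 / 5 * (1 / 4).
    apply: (@le_trans _ _ (s * (1 / 4))); first by apply: ler_wpM2l => //; lra.
    by apply: ler_wpM2r => //; lra.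
  lra.
have a2 : alpha < pi / 2.
  rewrite -(ltr_cos (x := alpha) (y := pi / 2)) ?in_itv /= ?cos_pihalf ?ca; lra.
have b2 : alpha + eps / 4 < pi / 2.
  have bpi : alpha + eps / 4 <= pi by lra.
  by rewrite -(ltr_cos (x := alpha + eps / 4) (y := pi / 2)) ?in_itv /= ?cos_pihalf //; lra.
split=> //; [|rewrite ltr_cos ?in_itv /=|..]; try lra.
by rewrite -sa ltr_sin ?in_itv /=; lra.
Qed.

Lemma cos_outside_arc {R : realType} (x c h width : R) : width = 2 * h ->
  0 <= h -> h <= pi -> ~ arc c width x -> cos (x - c) <= cos h.
Proof.
move=> wh h0 hpi out; have [k kP] := reduce_mod_2pi (x - c).
rewrite -(@periodic_int _ cos (pi *+ 2) k (x - c)); last exact: cosD2pi.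
set y := x - c - _ in kP *.
have hy : h < `|y|.
  rewrite ltNge; apply/negP => yh; apply: out; exists k.
  by rewrite wh mulrAC divff ?mul1r.
rewrite -cos_norm; apply/ltW; rewrite ltr_cos ?in_itv /= ?h0 ?normr_ge0 //=.
by rewrite ler_norml.
Qed.

Lemma Linfty_norm_le {R : realType} (h : R -> R -> R) (B : R) :
  0 <= B -> (forall x w, `|h x w| <= B) -> (Linfty_norm h <= B%:E)%E.
Proof.
move=> B0 hB; rewrite /Linfty_norm unlock; case: ifPn => _; last by rewrite lee_fin.
apply/ess_supP; apply: aeW => z /=; rewrite lee_fin patchE.
by case: ifPn => _; rewrite ?normr0.
Qed.

Theorem theorem3p3 (R : realType) :
  exists K0 : R -> R -> R,
  forall (M K : R) (g : R -> R) (f0 : R -> R -> R) (f : R -> R -> R -> R)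
    (r phi : R -> R),
    0 < M -> 0 < K ->
    frequency_density g M ->
    initial_datum g f0 ->
    classical_solution K f0 f ->
    order_parameters f r phi ->
    0 < r 0 ->
    K0 M (r 0)^-1 <= K ->
    ((R_infty M K)%:E <= limf_einf (fun t => (r t)%:E) (pinfty_nbhs R))%E /\
    forall eps : R, 0 < eps < 1 ->
      Linfty_norm (fun x w =>
        f x w t * \1_(~` arc (phi t) (L_infty_width M K eps)) x)
        @[t --> +oo] --> 0%E.
Proof.
(* With q = 1 / R_0 and rho = R_0 / 4, the factor 4 q is 1 / rho and the requirement reads 400 M <=
   K rho^3. *)
exists (fun M q => 400 * M * (4 * q) ^+ 3) => M K g f0 f r phi M0 K0 gP f0P fP rP r0 KR.
have XE (t : R) : 0 <= t -> mean_cos M f t = r t * cos (phi t).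
  move=> t0; have [_ -> _] := rP t t0.
  by apply: (mean_angle gP f0P fP t0); exact: continuous_cos.
have YE (t : R) : 0 <= t -> mean_sin M f t = r t * sin (phi t).
  move=> t0; have [_ _ ->] := rP t t0.
  by apply: (mean_angle gP f0P fP t0); exact: continuous_sin.
have rE (t : R) : 0 <= t -> radius M f t = r t.
  move=> t0; have [/andP[rt _] _ _] := rP t t0.
  rewrite /radius XE // YE // !exprMn -mulrDr cos2Dsin2 mulr1 sqrtr_sqr.
  by rewrite ger0_norm.
have R0 : 0 < radius M f 0 by rewrite rE.
have KR' : 400 * M * (4 / radius M f 0) ^+ 3 <= K by rewrite rE.
have [low decay] := asymptotics M0 gP f0P fP K0 R0 KR'.
have MK : 400 * M <= K.
  have [/andP[_ r1] _ _] := rP 0 (lexx 0).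
  have M400 : 0 <= 400 * M := mulr_ge0 (ler0n _ 400) (ltW M0).
  apply: le_trans KR; rewrite -[X in X <= _]mulr1; apply: (ler_wpM2l M400).
  apply: exprn_ege1; rewrite -[4 * _]/(4 / r 0) ler_pdivlMr //; lra.
split.
  rewrite limf_einfE; apply/lee_addgt0Pr => e e0.
  have [T hT] := low e e0.
  rewrite -leeBlDr // -EFinB.
  apply: le_trans (ereal_sup_ubound _); last first.
    exists [set t | Num.max T 0 <= t] => //.
    by exists (Num.max T 0); split => [|x /ltW]; rewrite ?num_real.
  apply: le_ereal_inf_tmp => _ [t /= tT <-]; move: tT; rewrite ge_max => /andP[tT t0].
  by rewrite lee_fin -rE //; exact: hT.
move=> eps epsP.
have [st0 st5] := sin_trap_bounds M0 K0 MK.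
have [ca sa cc h0 hpi] := trap_angles st0 st5 epsP.
set alpha := acos _ in ca sa cc h0 hpi.
have wE : L_infty_width M K eps = 2 * (alpha + eps / 2).
  by rewrite /L_infty_width /= -/sin_trap -/alpha; field.
have [T [C [lam [T0 C0 lam0 hT]]]] := decay _ _ ca sa (cos2Dsin2 _).
(* Decay is applied with the narrower half width alpha + eps / 4. Outside the arc of half width
   alpha + eps / 2 the weight is then at least eta, and dividing by eta bounds f itself. *)
pose eta := (cos (alpha + eps / 4) - cos (alpha + eps / 2)) ^+ 2.
have eta0 : 0 < eta by rewrite exprn_gt0 // subr_gt0.
pose B t := C / eta * expR (- (lam * t)).
have Ce : 0 <= C / eta by rewrite divr_ge0 // ltW.
have B0 t : 0 <= B t by rewrite mulr_ge0 // expR_ge0.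
have [_ fge0 _ _ _] := fP.1.
have bound t : T <= t -> (Linfty_norm (fun x w =>
    (f x w t * \1_(~` arc (phi t) (L_infty_width M K eps)) x)%R) <= (B t)%:E)%E.
  move=> tT; have t0 : 0 < t := lt_le_trans T0 tT.
  apply: Linfty_norm_le => // x w; rewrite indicE.
  have [|_] := boolP (x \in _); last by rewrite mulr0 normr0.
  rewrite inE mulr1 /= => out; rewrite ger0_norm; last exact: fge0 (ltW t0).
  have [rt fe] := hT x w t tT.
  (* No regularity of [phi] enters: r cos phi and r sin phi are the moments, and r > 0. *)
  have relE : relcos M f x t = cos (x - phi t).
    rewrite /relcos XE ?(ltW t0) // YE ?(ltW t0) // -rE ?(ltW t0) // cosB.
    by field; rewrite gt_eqF.
  have co := cos_outside_arc wE h0 hpi out.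
  rewrite /B mulrAC ler_pdivlMr //; apply: le_trans fe.
  apply: ler_wpM2l; first exact: fge0 (ltW t0).
  rewrite /pos_sqr /eta ler_pXn2r ?nnegrE ?le_max ?lexx //; last first.
    by rewrite subr_ge0 ltW.
  by rewrite relE; apply/orP; right; rewrite lerB.
have BT : (B t)%:E @[t --> +oo] --> 0%E.
  apply: cvg_EFin; first exact: nearW.
  apply/cvgrPdist_le => e e0; near=> t.
  rewrite /= sub0r normrN ger0_norm ?B0 //; apply: (scaled_exp_small Ce lam0 e0).
  by near: t; apply: nbhs_pinfty_ge; rewrite num_real.
apply: (@squeeze_cvge _ _ _ _ (cst 0%E) _ (fun t => (B t)%:E)) => //; last exact: cvg_cst.
near=> t; rewrite /cst /=; apply/andP; split; first exact: Lnorm_ge0.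
by apply: bound; near: t; apply: nbhs_pinfty_ge; rewrite num_real.
Unshelve. all: by end_near. Qed.
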